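(* Let $1\le m\le n$ and let $A_1,\dots,A_m\in\Gamma_m$. Then $$\binom{n}{m}\det(A_1,\dots,A_m,I,\dots,I)\ \geq\ \mathcal H_m(A_1)^{\frac1m}\cdots \mathcal H_m(A_m)^{\frac1m},$$ where $I$ is the $n\times n$ identity matrix, repeated $n-m$ times in the mixed determinant.
   Context: Let $\mathscr H^n$ be the real vector space of hyperhermitian quaternionic $n\times n$ matrices $A=(a_{ij})$, i.e. $a_{ij}=\overline{a_{ji}}$. The Moore determinant of $M=(M_{ij})\in\mathscr H^n$ is $$\det M=\sum_{\sigma\in S_n}\operatorname{sgn}(\sigma)\,M_{n_{11}n_{12}}\cdots M_{n_{1l_1}n_{11}}M_{n_{21}n_{22}}\cdots M_{n_{rl_r}n_{r1}},$$ where each permutation $\sigma$ is written as a product of disjoint cycles $\sigma=(n_{11}\dots n_{1l_1})(n_{21}\dots n_{2l_2})\cdots(n_{r1}\dots n_{rl_r})$ with $n_{i1}<n_{ij}$ for all $j>1$ and $n_{11}>n_{21}>\dots>n_{r1}$. The mixed determinant $\det(M_1,\dots,M_n)$ of $M_1,\dots,M_n\in\mathscr H^n$ is the coefficient of the monomial $s_1\cdots s_n$ in the polynomial $\det(s_1M_1+\dots+s_nM_n)$ of the real variables $s_1,\dots,s_n$, divided by $n!$. Every $A\in\mathscr H^n$ can be written $A=U\operatorname{diag}(\lambda_1,\dots,\lambda_n)U^*$ with $U$ quaternionic unitary and $\lambda_j\in\mathbb R$; the $\lambda_j=\lambda_j(A)$ are the eigenvalues of $A$. Put $$\mathcal H_m(A)=\sum_{1\le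 j_1<\dots<j_m\le n}\lambda_{j_1}(A)\cdots\lambda_{j_m}(A),\qquad \Gamma_m=\{A\in\mathscr H^n:\ \mathcal H_m(sI+A)>0\ \text{for all } s\ge0\}.$$ *)

(* Defs.v *)
From HB Require Import structures.
From mathcomp Require Import all_boot all_order all_algebra all_fingroup.
From mathcomp Require Import ring.
From mathcomp Require Import boolp classical_sets reals.
From mathcomp Require Import mpoly.

Set Implicit Arguments.
Unset Strict Implicit.
Unset Printing Implicit Defensive.

Import Order.TTheory GRing.Theory Num.Theory.
Local Open Scope ring_scope.

(* [Quat a b c d] is a + b i + c j + d k.  The coefficient ring is arbitrary so
   that quaternions with polynomial coefficients are available as well. *)
Record quat (K : Type) := Quat { qre : K; qi : K; qj : K; qk : K }.

Section QuatRing.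
Variable K : comNzRingType.

Definition tuple_of_quat (x : quat K) : K * K * K * K :=
  (qre x, qi x, qj x, qk x).
Definition quat_of_tuple (t : K * K * K * K) : quat K :=
  let: (a, b, c, d) := t in Quat a b c d.

Lemma tuple_of_quatK : cancel tuple_of_quat quat_of_tuple.
Proof. by case. Qed.

HB.instance Definition _ := Choice.copy (quat K) (can_type tuple_of_quatK).

Definition quat_add (x y : quat K) :=
  Quat (qre x + qre y) (qi x + qi y) (qj x + qj y) (qk x + qk y).
Definition quat_opp (x : quat K) :=
  Quat (- qre x) (- qi x) (- qj x) (- qk x).

(* i^2 = j^2 = k^2 = ijk = -1 *)
Definition quat_mul (x y : quat K) :=
  let: Quat a b c d := x in let: Quat a' b' c' d' := y in
  Quat (a * a' - b * b' - c * c' - d * d')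
       (a * b' + b * a' + c * d' - d * c')
       (a * c' - b * d' + c * a' + d * b')
       (a * d' + b * c' - c * b' + d * a').

Definition quat_real (a : K) := Quat a 0 0 0.

Definition quat_conj (x : quat K) :=
  Quat (qre x) (- qi x) (- qj x) (- qk x).

Lemma quat_addA : associative quat_add.
Proof. by move=> x y z; congr Quat; rewrite /= addrA. Qed.
Lemma quat_addC : commutative quat_add.
Proof. by move=> x y; congr Quat; rewrite /= addrC. Qed.
Lemma quat_add0 : left_id (quat_real 0) quat_add.
Proof. by case=> *; congr Quat; rewrite /= add0r. Qed.
Lemma quat_addN : left_inverse (quat_real 0) quat_opp quat_add.
Proof. by case=> *; congr Quat; rewrite /= addNr. Qed.

HB.instance Definition _ :=
  GRing.isZmodule.Build (quat K) quat_addA quat_addC quat_add0 quat_addN.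

Lemma quat_mulA : associative quat_mul.
Proof. by case=> ????[????][????]; congr Quat; ring. Qed.
Lemma quat_mul1 : left_id (quat_real 1) quat_mul.
Proof. by case=> ????; congr Quat; ring. Qed.
Lemma quat_mulr1 : right_id (quat_real 1) quat_mul.
Proof. by case=> ????; congr Quat; ring. Qed.
Lemma quat_mulDl : left_distributive quat_mul +%R.
Proof. by case=> ????[????][????]; congr Quat; rewrite /=; ring. Qed.
Lemma quat_mulDr : right_distributive quat_mul +%R.
Proof. by case=> ????[????][????]; congr Quat; rewrite /=; ring. Qed.
Lemma quat_1neq0 : quat_real 1 != 0.
Proof. by apply/eqP=> -[] /eqP; rewrite oner_eq0. Qed.

HB.instance Definition _ :=
  GRing.Zmodule_isNzRing.Build (quat K) quat_mulA quat_mul1 quat_mulr1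
    quat_mulDl quat_mulDr quat_1neq0.

End QuatRing.

Definition quat_map (K L : Type) (f : K -> L) (x : quat K) : quat L :=
  Quat (f (qre x)) (f (qi x)) (f (qj x)) (f (qk x)).

Definition adjmx (K : comNzRingType) (m n : nat) (A : 'M[quat K]_(m, n)) :
  'M[quat K]_(n, m) := map_mx (@quat_conj K) A^T.

Definition hyperhermitian (K : comNzRingType) (n : nat) (A : 'M[quat K]_n) :
  Prop := A = adjmx A.

Definition quat_unitary (K : comNzRingType) (n : nat) (U : 'M[quat K]_n) :
  Prop := U *m adjmx U = 1%:M /\ adjmx U *m U = 1%:M.

(* [i] is the least element of its cycle under [s]. *)
Definition cycle_leader (n : nat) (s : 'S_n) (i : 'I_n) : bool :=
  [forall j in porbit s i, (i <= j)%N].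

(* Cycles are taken in decreasing order of their least elements (whence [rev]),
   and [fingraph.orbit s i] is the list i, s i, s (s i), ... of a cycle, read
   from its least element. *)
Definition moore_sum (K : comNzRingType) (n : nat) (M : 'M[quat K]_n) :
  quat K :=
  \sum_(s : 'S_n) (-1) ^+ s *
    \prod_(i <- rev (enum 'I_n) | cycle_leader s i)
      \prod_(j <- fingraph.orbit s i) M j (s j).

(* On a hyperhermitian matrix the i, j, k components of [moore_sum] vanish, since
   the reversal of a cycle conjugates its product. *)
Definition moore_det (K : comNzRingType) (n : nat) (M : 'M[quat K]_n) : K :=
  qre (moore_sum M).

(* det (s_1 M_1 + ... + s_n M_n) as a polynomial in the indeterminates s_i. *)
Definition moore_poly (K : comNzRingType) (n : nat) (M : 'I_n -> 'M[quat K]_n) :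
  {mpoly K[n]} :=
  moore_det (\sum_(i < n)
    quat_real 'X_i *: map_mx (quat_map (@mpolyC n K)) (M i)).

Definition mixed_det (K : fieldType) (n : nat) (M : 'I_n -> 'M[quat K]_n) : K :=
  (moore_poly M)@_[multinom 1%N | i < n] / n`!%:R.

Definition is_spectrum (R : realType) (n : nat) (A : 'M[quat R]_n)
    (lam : 'rV[R]_n) : Prop :=
  exists U : 'M[quat R]_n, quat_unitary U /\
    A = U *m diag_mx (map_mx (@quat_real R) lam) *m adjmx U.

(* A choice of eigenvalues, unique up to order when A is hyperhermitian;
   0 if there is none. *)
Definition eigenvalues (R : realType) (n : nat) (A : 'M[quat R]_n) : 'rV[R]_n :=
  xget 0 (is_spectrum A).

Definition esym_eig (R : realType) (n m : nat) (A : 'M[quat R]_n) : R :=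
  \sum_(J : {set 'I_n} | #|J| == m) \prod_(j in J) eigenvalues A 0 j.

Definition Gamma (R : realType) (n m : nat) : set 'M[quat R]_n :=
  fun A => hyperhermitian A /\
    forall s : R, 0 <= s -> 0 < esym_eig m ((quat_real s)%:M + A).

(* (A_1, ..., A_m, I, ..., I) *)
Definition pad_id (R : realType) (n m : nat) (A : 'I_m -> 'M[quat R]_n)
    (i : 'I_n) : 'M[quat R]_n :=
  if insub (val i) is Some j then A j else 1%:M.

(* Main.v *)
(* The Moore determinant is expanded along the cycle through a chosen index.
   Contracting the last vertex of that cycle gives a recursion for the principal
   minors D(S) and for the products W(S, i, j) = D(S) * (Schur complement), from
   which Cramer's rule over the quaternions follows by induction on #|S|.
   Gaussian elimination then yields (Moore det A)^4 = det (rmx A), where rmx A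
   is the real 4n x 4n matrix of A; as rmx A is symmetric, s |-> det (s I + A) is
   real-rooted, and it equals \prod_j (s + lambda_j).

   So F (x, s) = det (sum_j x_j A_j + s I) is hyperbolic in the direction s, and
   so is its (n - m)-th s-derivative G, which is (n - m)! H_m.  Garding's theory
   applies to G: roots stay in a half plane along a homotopy, hence G (x + i v)
   does not vanish for v in the cone generated by the A_j, and by Gauss-Lucas
   this is inherited by derivatives in the directions A_j.  Finally
   Q = dG/dx_i satisfies (Q (A_j) / m)^m >= G (A_i) G (A_j)^(m - 1) by AM-GM on
   the roots of t |-> G (A_j + t A_i), and induction on m gives the result. *)
From HB Require Import structures.
Require Import Defs.
From mathcomp Require Import all_boot all_order all_algebra all_fingroup.
From mathcomp Require Import ring lra complex.

Set Implicit Arguments.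
Unset Strict Implicit.
Unset Printing Implicit Defensive.

Import Order.TTheory GRing.Theory Num.Theory.
Local Open Scope ring_scope.

(** * Cycle expansion of the Moore determinant *)

(** Quaternions do not commute, and the Moore determinant prescribes the order of its cycle
    products, so only the cycle of the least index can be split off directly. Replacing each cycle
    product by its real part ([rpart]) removes the obstacle: the factors become central and the
    cycle of any index may be singled out. That both sums agree on hyperhermitian matrices is proved
    only after the recursion and its mirror image are known ([Dsum_id]). The link to ordinary
    determinants is the real representation, where each quaternionic scalar occupies four real
    dimensions; this is why only a fourth power of the Moore determinant appears. Nothing is lost:
    two monic polynomials with equal fourth powers agree when 2 is nonzero. The algebra is kept over
    general commutative rings and integral domains because it is applied to matrices with polynomial
    entries as well. The [n - m] identity matrices share a single variable, so the analysis takes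
    place in [m + 1] variables and the identity direction is the direction of hyperbolicity. *)

Local Notation porb := fingraph.orbit.

Section PermOrbit.
Variable n : nat.
Implicit Types (s t : 'S_n) (S : {set 'I_n}).

Lemma orbit_cycle_uniq s x l :
  fcycle s (x :: l) -> uniq (x :: l) -> porb s x = x :: l.
Proof. by move=> cl ul; rewrite -[RHS]undup_id// (undup_cycle_cons cl). Qed.

Lemma porbit_orbit s x y : (y \in porbit s x) = (y \in porb s x).
Proof.
rewrite -fconnect_orbit; apply/idP/idP.
  by case/porbitP=> i ->; rewrite permX; exact: fconnect_iter.
by move/iter_findex<-; rewrite -permX mem_porbit.
Qed.

Lemma orbit_perm_on s S x y :
  perm_on S s -> x \in S -> y \in porb s x -> y \in S.
Proof.
move=> sS xS; rewrite -fconnect_orbit => /iter_findex<-.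
by elim: (findex _ _ _) => //= k IH; rewrite perm_closed.
Qed.

Lemma cycle_leader_eq s t i : porb s i = porb t i ->
  cycle_leader s i = cycle_leader t i.
Proof.
by move=> e; rewrite /cycle_leader; apply: eq_forallb => j;
   rewrite !porbit_orbit e.
Qed.

Lemma orbit_fix s j : s j = j -> porb s j = [:: j].
Proof. by move=> sj; apply: orbit_cycle_uniq; rewrite //= sj eqxx. Qed.

Variables (S : {set 'I_n}) (j k : 'I_n) (s : 'S_n).
Hypotheses (jS : j \notin S) (kS : k \in S) (sS : perm_on (j |: S :\ k) s).
Let t := (s * tperm k j)%g.

Let jk : j != k. Proof. by apply: contraNneq jS => ->. Qed.
Let sk : s k = k.
Proof. by apply: (out_perm sS); rewrite !inE eqxx eq_sym (negbTE jk). Qed.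

Lemma notin_orbit : k \notin porb s j.
Proof.
apply/negP => kj; have := orbit_perm_on sS (setU11 _ _) kj.
by rewrite !inE eqxx eq_sym (negbTE jk).
Qed.

(** Products of permutations act from left to right: [t] sends the last vertex of the cycle of [j]
    to [k], and the former fixed point [k] to [j]. Thus [k] enters as the new last vertex. *)
Lemma orbit_insert : porb t j = rcons (porb s j) k.
Proof.
have /= := cycle_orbit (@perm_inj _ s) j.
have := orbit_uniq s j; have := notin_orbit.
have : head k (porb s j) = j by rewrite /fingraph.orbit -orderSpred.
case: (porb s j) => [/= kj|x0 l /= ->]; first by move: jk; rewrite kj eqxx.
move=> kl ul; rewrite rcons_path => /andP[pl /eqP lj].
apply: orbit_cycle_uniq; last first.
  by rewrite -rcons_cons rcons_uniq kl.
rewrite /= rcons_path last_rcons; apply/andP; split; last first.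
  by rewrite /= /t permM sk tpermL.
rewrite rcons_path /= /t permM lj tpermR eqxx andbT.
have ul' : j \notin l by case/andP: ul.
have kl' : k \notin l by move: kl; rewrite inE negb_or => /andP[].
have: fpath s j l -> fpath (s * tperm k j)%g j l; last exact.
move: {1 3}j; elim: l ul' kl' {kl ul lj pl} => //= y l IH;
  rewrite !inE !negb_or.
move=> /andP[jy jl] /andP[ky kl] x /andP[/eqP sx pl].
by rewrite permM sx tpermD //= eqxx IH.
Qed.

Lemma orbit_insert_out l : l != k -> l \notin porb s j -> porb t l = porb s l.
Proof.
move=> lk lj.
have jl : j \notin porb s l by rewrite -porbit_orbit porbit_sym porbit_orbit.
have kl : k \notin porb s l.
  rewrite -porbit_orbit porbit_sym porbit_orbit orbit_fix//.
  by rewrite inE.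
have cs := cycle_orbit (@perm_inj _ s) l.
have : fcycle t (porb s l).
  rewrite -(@eq_in_cycle _ [in porb s l] (frel s) (frel t)) //.
  move=> x y xl yl /=.
  have sxl : s x \in porb s l.
    rewrite -fconnect_orbit (connect_trans _ (fconnect1 s x))//.
    by rewrite fconnect_orbit.
  rewrite /t permM tpermD //.
    by apply: contraNneq kl => ->.
  by apply: contraNneq jl => ->.
have := orbit_uniq s l.
have : head l (porb s l) = l by rewrite /fingraph.orbit -orderSpred.
have : porb s l <> [::] by rewrite /fingraph.orbit -orderSpred.
by case: (porb s l) => // x r _ /= -> ur cr; apply: orbit_cycle_uniq.
Qed.

End PermOrbit.

Section QuatTheory.
Variable K : comNzRingType.
Implicit Types x y : quat K.

Lemma quatE x y :
  qre x = qre y -> qi x = qi y -> qj x = qj y -> qk x = qk y -> x = y.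
Proof. by case: x; case: y => /= ? ? ? ? ? ? ? ? -> -> -> ->. Qed.

Lemma qreM x y : qre (x * y) =
  qre x * qre y - qi x * qi y - qj x * qj y - qk x * qk y.
Proof. by case: x; case: y. Qed.

Fact quat_real_zmod : zmod_morphism (@quat_real K).
Proof. by move=> a b; apply: quatE; rewrite /= ?subr0. Qed.
Fact quat_real_monoid : monoid_morphism (@quat_real K).
Proof. by split=> // a b; apply: quatE => /=; ring. Qed.
HB.instance Definition _ :=
  GRing.isZmodMorphism.Build K (quat K) (@quat_real K) quat_real_zmod.
HB.instance Definition _ :=
  GRing.isMonoidMorphism.Build K (quat K) (@quat_real K) quat_real_monoid.

Fact qre_zmod : zmod_morphism (@qre K). Proof. by []. Qed.
HB.instance Definition _ := GRing.isZmodMorphism.Build (quat K) K (@qre K)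
  qre_zmod.

Fact quat_conj_zmod : zmod_morphism (@quat_conj K).
Proof. by move=> x y; apply: quatE => //=; rewrite opprD. Qed.
HB.instance Definition _ :=
  GRing.isZmodMorphism.Build (quat K) (quat K) (@quat_conj K) quat_conj_zmod.

Lemma quat_conjM x y : quat_conj (x * y) = quat_conj y * quat_conj x.
Proof. by case: x; case: y => *; apply: quatE => /=; ring. Qed.
Lemma quat_conj_real (a : K) : quat_conj (quat_real a) = quat_real a.
Proof. by apply: quatE; rewrite /= ?oppr0. Qed.
Lemma quat_realC (a : K) x : quat_real a * x = x * quat_real a.
Proof. by case: x => *; apply: quatE => /=; ring. Qed.
Lemma qre_realM (a : K) x : qre (quat_real a * x) = a * qre x.
Proof. by rewrite qreM /= !mul0r !subr0. Qed.
Lemma qreMC x y : qre (x * y) = qre (y * x).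
Proof. by rewrite !qreM; ring. Qed.

End QuatTheory.

(** * Signed sums over permutations and their recursion *)

Section MooreSums.
Variables (K : comNzRingType) (n : nat) (M : 'M[quat K]_n).
Implicit Types (s : 'S_n) (S : {set 'I_n}) (f : quat K -> quat K).

(** The endpoint [i] is kept apart from the list: with the first vertex as [i] this is a cycle
    product, with another [i] it is the open path that contraction leaves behind. *)
Fixpoint wordl (l : seq 'I_n) (i : 'I_n) : quat K :=
  if l is x :: l' then M x (head i l') * wordl l' i else 1.

Lemma wordl_rcons l k i : wordl (rcons l k) i = wordl l k * M k i.
Proof.
elim: l => [|x l IH] /=; first by rewrite mulr1 mul1r.
by rewrite IH mulrA; case: l {IH}.
Qed.

Lemma wordl_orbit s j :
  wordl (porb s j) j = \prod_(a <- porb s j) M a (s a).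
Proof.
have := cycle_orbit (@perm_inj _ s) j.
have : head j (porb s j) = j by rewrite /fingraph.orbit -orderSpred.
have : porb s j <> [::] by rewrite /fingraph.orbit -orderSpred.
case: (porb s j) => // x l _ /= ->.
suff: forall y i, path (frel s) y (rcons l i) ->
  wordl (y :: l) i = \prod_(a <- y :: l) M a (s a) by apply.
elim: l => [|z l IH] y i /=.
  by rewrite andbT big_seq1 mulr1 => /eqP->.
by case/andP=> /eqP yz /(IH z i) /= ->; rewrite [RHS]big_cons yz.
Qed.

Definition cycw s l := wordl (porb s l) l.

(** With [f := id] the factors must stay in Moore's order; with [f := rpart] they are central and
    the order is immaterial. *)
Definition Dsum f S : quat K :=
  \sum_(s : 'S_n | perm_on S s) (-1) ^+ s *
    \prod_(l <- rev (enum 'I_n) | (l \in S) && cycle_leader s l) f (cycw s l).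

(* The cycle of j comes last and its closing edge is redirected to i. *)
Definition Wsum f S i j : quat K :=
  \sum_(s : 'S_n | perm_on (j |: S) s) (-1) ^+ s *
    (\prod_(l <- rev (enum 'I_n) |
        [&& l \in S, l \notin porb s j & cycle_leader s l]) f (cycw s l)) *
    wordl (porb s j) i.

(** Sort the permutations by the predecessor [k] of [j]. If [k = j], the cycle is the single edge
    from [j] to [i]. Otherwise [k] is the last vertex of the cycle; removing it takes off the edge
    from [k] to [i], makes [k] the new endpoint and flips the sign. *)
Lemma Wsum_rec f S i j : j \notin S ->
  Wsum f S i j = Dsum f S * M j i - \sum_(k in S) Wsum f (S :\ k) k j * M k i.
Proof.
move=> jS; rewrite /Wsum.
rewrite (partition_big (fun s : 'S_n => s^-1%g j) (mem (j |: S))) /=;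
  last first.
  by move=> s sS; rewrite (perm_closed _ (perm_onV sS)) setU11.
rewrite big_setU1//= -sumrN; congr (_ + _).
  rewrite mulr_suml; apply: eq_big => [s|s /andP[sS /eqP sj]].
    apply/andP/idP => [[sS /eqP sj]|sS].
      have {}sj : s j = j by rewrite -{1}sj permKV.
      apply/subsetP => x; rewrite !inE => xs.
      have := subsetP sS x; rewrite !inE => /(_ xs) /orP[/eqP xj|//].
      by rewrite xj sj eqxx in xs.
    split; first by apply: subset_trans sS _; apply: subsetUr.
    by apply/eqP; rewrite -[in LHS](out_perm sS jS) permK.
  have {}sj : s j = j by rewrite -{1}sj permKV.
  rewrite (orbit_fix sj) /= mulr1; congr (_ * _ * _).
  apply: eq_bigl => l; rewrite !inE; case: eqP => // ->.
  by rewrite (negbTE jS).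
apply: eq_bigr => k kS; rewrite -mulNr.
have jk : j != k by apply: contraNneq jS => ->.
(* [h] is an involution, hence serves both as the contraction of [k] and as its insertion. *)
pose h (s : 'S_n) := (s * tperm k j)%g.
have hh s : h (h s) = s by rewrite /h -mulgA tperm2 mulg1.
rewrite (reindex_onto h h) //=.
have domE s : perm_on (j |: S) (h s) && ((h s)^-1%g j == k) && (h (h s) == s)
    = perm_on (j |: S :\ k) s.
  rewrite hh eqxx andbT; apply/andP/idP => [[hS /eqP hk]|sS].
    have sk : s k = k.
      have : h s k = j by rewrite -hk permKV.
      rewrite /h permM => /(congr1 (tperm k j)); rewrite tpermK => ->.
      by rewrite tpermR.
    have kjS : perm_on (j |: S) (tperm k j).
      apply: subset_trans (tperm_on k j) _; apply/subsetP => x.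
      by rewrite !inE => /orP[]/eqP->; rewrite ?kS ?eqxx ?orbT.
    have : perm_on (j |: S) s by rewrite -(hh s); exact: perm_onM.
    move=> /subsetP sS; apply/subsetP => x; rewrite !inE => xs.
    have := sS x; rewrite !inE => /(_ xs); case: eqP => //= _ ->.
    by rewrite andbT; apply: contraNneq xs => ->; rewrite sk.
  have sk : s k = k.
    by apply: (out_perm sS); rewrite !inE eqxx eq_sym (negbTE jk).
  split; last by rewrite /h invMg tpermV permM tpermR (canLR (permK s) (esym
    sk)).
  apply: perm_onM.
    by apply: subset_trans sS _; apply: setUS; apply: subD1set.
  apply: subset_trans (tperm_on k j) _; apply/subsetP => x.
  by rewrite !inE => /orP[]/eqP->; rewrite ?kS ?eqxx ?orbT.
rewrite (eq_bigl _ _ domE) -sumrN mulr_suml; apply: eq_bigr => s sS.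
rewrite /h odd_permM odd_tperm eq_sym jk.
rewrite (orbit_insert jS kS sS) wordl_rcons !mulrA -!mulNr; congr (_ * _ * _).
have leadE l : [&& l \in S, l \notin rcons (porb s j) k & cycle_leader (h s) l]
    = [&& l \in S :\ k, l \notin porb s j & cycle_leader s l].
  rewrite !inE mem_rcons inE negb_or; case: eqP => [_|/eqP lk] /=;
    first by rewrite andbF.
  congr (_ && _); case lj: (l \in porb s j) => //=.
  by apply: cycle_leader_eq; rewrite (orbit_insert_out jS kS sS) ?lj.
rewrite -/(h s) (eq_bigl _ _ leadE); congr (_ * _); first by case: (s : bool);
  rewrite ?mulN1r ?opprK.
by apply: eq_bigr => l /and3P[]; rewrite !inE => /andP[lk lS] lj _;
  rewrite /cycw (orbit_insert_out jS kS sS lk lj).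
Qed.

Lemma Dsum0 f : Dsum f set0 = 1.
Proof.
rewrite /Dsum (big_pred1 1%g) => [|s]; last first.
  apply/idP/eqP => [|->]; last exact: perm_on1.
  by move/perm_on_id; rewrite cards0; apply.
by rewrite odd_perm1 big_pred0 ?mulr1 // => l; rewrite inE.
Qed.

Lemma moore_sumE : moore_sum M = Dsum id setT.
Proof.
apply: eq_big => [s|s _]; first by apply/esym/subsetP => x; rewrite inE.
congr (_ * _); apply: eq_big => [l|l _]; first by rewrite inE.
by rewrite /cycw wordl_orbit.
Qed.

(** The enumeration is decreasing, so an index below all the others contributes the rightmost
    factor. *)
Lemma prod_rev_enum_min (P Q : pred 'I_n) (F : 'I_n -> quat K) j :
    (forall l, P l = (l == j) || Q l) -> (forall l, Q l -> (j < l)%N) ->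
  \prod_(l <- rev (enum 'I_n) | P l) F l =
  (\prod_(l <- rev (enum 'I_n) | Q l) F l) * F j.
Proof.
move=> PE Qj.
have jr : j \in rev (enum 'I_n) by rewrite mem_rev mem_enum.
have : sorted (fun a b : 'I_n => (b < a)%N) (rev (enum 'I_n)).
  have := iota_ltn_sorted 0 n; rewrite -val_enum_ord sorted_map.
  by rewrite rev_sorted.
have trans : transitive (fun a b : 'I_n => (b < a)%N).
  by move=> y x z yx zy; apply: ltn_trans zy yx.
rewrite (sorted_pairwise trans); case/splitPr: jr => r1 r2.
rewrite pairwise_cat pairwise_cons => /and4P[r12 _ /allP jr2 _].
rewrite !big_cat !big_cons /=.
have -> : P j by rewrite PE eqxx.
have /negbTE-> : ~~ Q j by apply/negP => /Qj; rewrite ltnn.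
have -> : \prod_(l <- r2 | P l) F l = 1.
  rewrite big_seq_cond big_pred0// => l; apply/andP => -[/jr2 lj].
  by rewrite PE => /orP[/eqP le|/Qj jl];
    [rewrite le ltnn in lj|have := ltn_trans lj jl; rewrite ltnn].
have -> : \prod_(l <- r2 | Q l) F l = 1.
  rewrite big_seq_cond big_pred0// => l; apply/andP => -[/jr2 lj].
  by move=> /Qj jl; have := ltn_trans lj jl; rewrite ltnn.
rewrite !mulr1; congr (_ * _).
rewrite big_seq_cond [RHS]big_seq_cond; apply: eq_bigl => l.
case lr: (l \in r1) => //=; rewrite PE; case: eqP => // lj.
move: r12; rewrite allrel_consr => /andP[/allP/(_ l lr)].
by rewrite lj ltnn.
Qed.

(** The least index leads its own cycle, and Moore's order puts that cycle last, which is exactly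
    the shape of [Wsum]. *)
Lemma Dsum_min S (j : 'I_n) : (forall x, x \in S -> (j < x)%N) ->
  Dsum id (j |: S) = Wsum id S j j.
Proof.
move=> jS; apply: eq_bigr => s sS; rewrite -mulrA; congr (_ * _).
apply: (@prod_rev_enum_min _ _ (cycw s)) => [l|l /andP[/jS]//].
rewrite !inE; case: eqP => [->|/eqP lj] /=.
  apply/forallP => x; apply/implyP; rewrite porbit_orbit => xj.
  have := orbit_perm_on sS (setU11 _ _) xj; rewrite !inE.
  by case/orP=> [/eqP->//|/jS/ltnW].
case lS: (l \in S) => //=; case lo: (l \in porb s j) => //=.
apply/negP => /forallP/(_ j); rewrite porbit_sym porbit_orbit lo /=.
by rewrite leqNgt jS.
Qed.

Lemma leader_exists s j : exists2 l, l \in porb s j & cycle_leader s l.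
Proof.
have jj : j \in porb s j by rewrite in_orbit.
case: (@arg_minnP _ j (mem (porb s j)) (@nat_of_ord n) jj) => l /= lj lmin.
exists l => //; apply/forallP => x; apply/implyP.
have -> : porbit s l = porbit s j by apply/eqP;
  rewrite eq_porbit_mem porbit_orbit.
by rewrite porbit_orbit => /lmin.
Qed.

Lemma leader_uniq s l l' : cycle_leader s l -> cycle_leader s l' ->
  l \in porb s l' -> l = l'.
Proof.
move=> /forallP/(_ l') h /forallP/(_ l) h' ll'; apply/val_inj/eqP => /=.
move: h h'; rewrite porbit_sym !porbit_orbit ll' /= => h h'.
by rewrite eqn_leq h h'.
Qed.

Lemma qre_cycw s l l' : l \in porb s l' -> qre (cycw s l) = qre (cycw s l').
Proof.
move=> ll'; rewrite /cycw !wordl_orbit.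
have co := cycle_orbit (@perm_inj _ s) l'.
rewrite (fingraph.orbitE co (orbit_uniq _ _) ll').
by rewrite /rot big_cat /= qreMC -big_cat cat_take_drop.
Qed.

Definition rpart (x : quat K) : quat K := quat_real (qre x).

(** Real factors commute, and [qre (x * y) = qre (y * x)] makes the real part of a cycle product
    independent of its starting vertex. So the cycle of [j] can be moved to the end and read from
    [j], even when its leader is another index. *)
Lemma Dsum_rpart S j : j \notin S ->
  Dsum rpart (j |: S) = rpart (Wsum rpart S j j).
Proof.
move=> jS; rewrite /rpart /Wsum !raddf_sum; apply: eq_bigr => s sS.
rewrite -(rmorph_sign (@quat_real K)).
rewrite -!rmorph_prod -?mulrA /= !qre_realM !rmorphM; congr (_ * _).
rewrite -rmorphM; congr quat_real.
rewrite (perm_big _ (permEl (perm_rev _))) /=.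
rewrite [in RHS](perm_big _ (permEl (perm_rev _))) /= !big_enum_cond /=.
have [l lj ll] := leader_exists s j.
have lS := orbit_perm_on sS (setU11 _ _) lj.
rewrite (bigD1 l) /=; last by rewrite lS.
rewrite mulrC (qre_cycw lj); congr (_ * _); apply: eq_bigl => x.
rewrite !inE; case: (eqVneq x j) => [->|xj] /=.
  rewrite in_orbit /= andbF; apply/andP => -[jl].
  by rewrite (leader_uniq ll jl) ?eqxx.
case xS: (x \in S) => //=; case xo: (x \in porb s j) => /=; last first.
  by case: eqP => [xl|]; rewrite ?andbT // xl lj in xo *.
apply/andP => -[xl]; rewrite (leader_uniq ll xl) ?eqxx//.
by rewrite -porbit_orbit (_ : porbit s x = porbit s j) ?porbit_orbit//;
  apply/eqP; rewrite eq_porbit_mem porbit_orbit.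
Qed.

End MooreSums.

Lemma setD1C (T : finType) (S : {set T}) a b : S :\ a :\ b = S :\ b :\ a.
Proof. by rewrite !setDDl setUC. Qed.

Lemma exchange_setD1 (T : finType) (V : nmodType) (S : {set T})
    (F : T -> T -> V) :
  \sum_(k in S) \sum_(h in S :\ k) F k h =
  \sum_(h in S) \sum_(k in S :\ h) F k h.
Proof.
rewrite (exchange_big_dep [in S]) => [|k h _ /setD1P[]//] /=.
apply: eq_bigr => h hS; apply: eq_bigl => k.
by rewrite !inE hS andbT eq_sym andbC.
Qed.

Lemma hyperhermitian1 (K : comNzRingType) n :
  hyperhermitian (1%:M : 'M[quat K]_n).
Proof.
apply/matrixP => i j; rewrite !mxE eq_sym; case: (_ == _) => /=.
  by rewrite mulr1n (quat_conj_real (1 : K)).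
by rewrite mulr0n (quat_conj_real (0 : K)).
Qed.

(** * Principal minors and Schur complements over the quaternions *)

Section Minors.
Variables (K : comNzRingType) (n : nat) (M : 'M[quat K]_n).
Implicit Types (S : {set 'I_n}).

Definition pminor S : K := qre (Dsum M (@rpart K) S).
(* pschur S i j = pminor S * (M j i - M_jS M_SS^-1 M_Si) when M_SS is
   invertible. *)
Definition pschur S i j : quat K := Wsum M (@rpart K) S i j.

Lemma pminor0 : pminor set0 = 1.
Proof. by rewrite /pminor Dsum0. Qed.

Lemma pminorU1 S j : j \notin S -> pminor (j |: S) = qre (pschur S j j).
Proof. by move=> jS; rewrite /pminor Dsum_rpart. Qed.

Lemma Dsum_real S : Dsum M (@rpart K) S = quat_real (pminor S).
Proof.
have [->|[j jS]] := set_0Vmem S; first by rewrite pminor0 Dsum0.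
by rewrite -(setD1K jS) Dsum_rpart ?setD11 // pminorU1 ?setD11.
Qed.

Lemma pschurr S i j : j \notin S ->
  pschur S i j = quat_real (pminor S) * M j i
    - \sum_(k in S) pschur (S :\ k) k j * M k i.
Proof. by move=> jS; rewrite /pschur Wsum_rec // Dsum_real. Qed.

(** The mirror image of [pschurr], peeling off the first edge of a path instead of the last.
    Expanding once more on either side leads to the same double sum over ordered pairs of vertices,
    with one edge removed at each end. *)
Lemma pschurl S i j : j \notin S ->
  pschur S i j = M j i * quat_real (pminor S)
    - \sum_(k in S) M j k * pschur (S :\ k) i k.
Proof.
have [m] := ubnP #|S|; elim: m => // m IH in S i j * => Sm jS.
rewrite pschurr // -quat_realC; congr (_ - _).
pose F h k := M j h * pschur (S :\ h :\ k) k h * M k i.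
transitivity (\sum_(k in S) (M j k * quat_real (pminor (S :\ k)) * M k i
    - \sum_(h in S :\ k) F h k)).
  apply: eq_bigr => k kS; rewrite IH; last 2 first.
  - by rewrite -ltnS (leq_trans _ Sm) // ltnS [in leqRHS](cardsD1 k) kS.
  - by rewrite !inE negb_and jS orbT.
  rewrite mulrBl mulr_suml; congr (_ - _); apply: eq_bigr => h _.
  by rewrite /F setD1C.
rewrite sumrB exchange_setD1 -sumrB; apply: eq_bigr => k kS.
rewrite (@pschurr (S :\ k)) ?setD11// mulrBr mulrA mulr_sumr.
by congr (_ - _); apply: eq_bigr => h _; rewrite mulrA.
Qed.

Hypotheses (regK : forall x : K, x + x = 0 -> x = 0) (hM : hyperhermitian M).

Lemma hyperhermitianE i j : quat_conj (M i j) = M j i.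
Proof. by rewrite [in RHS]hM !mxE. Qed.

(** Conjugation reverses products, so it turns the expansion at the last edge into the one at the
    first edge. *)
Lemma pschur_conj S i j : i \notin S -> j \notin S ->
  quat_conj (pschur S i j) = pschur S j i.
Proof.
have [m] := ubnP #|S|; elim: m => // m IH in S i j * => Sm iS jS.
rewrite pschurr // pschurl // raddfB raddf_sum /= quat_conjM hyperhermitianE.
rewrite quat_conj_real; congr (_ - _); apply: eq_bigr => k kS.
rewrite quat_conjM hyperhermitianE IH ?setD11//.
- by rewrite -ltnS (leq_trans _ Sm) // ltnS [in leqRHS](cardsD1 k) kS.
- by rewrite !inE negb_and jS orbT.
Qed.

(** A diagonal value is its own conjugate, so each imaginary part equals its negative and vanishes
    by [regK]. *)
Lemma pschur_diag S i : i \notin S ->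
  pschur S i i = quat_real (pminor (i |: S)).
Proof.
move=> iS; rewrite pminorU1 //; have := pschur_conj iS iS.
case: (pschur S i i) => a b c d [] e1 e2 e3.
apply: quatE => //=; apply: regK.
- by rewrite -{1}e1 addNr.
- by rewrite -{1}e2 addNr.
- by rewrite -{1}e3 addNr.
Qed.

(* After expanding each pschur by pschurr, the coefficient of M h i is the same
   statement for S minus h, or pminor S when h = l. *)
Lemma pschur_cramer S i l : l \in S -> i \notin S ->
  \sum_(k in S) M l k * pschur (S :\ k) i k = M l i * quat_real (pminor S).
Proof.
have [m] := ubnP #|S|; elim: m => // m IH in S i l * => Sm lS iS.
pose F k h := M l k * pschur (S :\ k :\ h) h k * M h i.
transitivity (\sum_(k in S) (M l k * quat_real (pminor (S :\ k)) * M k i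
    - \sum_(h in S :\ k) F k h)).
  apply: eq_bigr => k kS; rewrite pschurr ?setD11// mulrBr mulrA mulr_sumr.
  by congr (_ - _); apply: eq_bigr => h _; rewrite mulrA.
rewrite sumrB exchange_setD1 -sumrB (bigD1 l) //= [X in _ + X]big1 ?addr0.
  rewrite /F -mulr_suml -mulrBl -[RHS]quat_realC.
  rewrite -[in RHS](setD1K lS) -pschur_diag ?setD11// pschurl ?setD11//.
  congr ((_ - _) * _); apply: eq_bigr => k _.
  by rewrite setD1C.
move=> h /andP[hS hl]; rewrite /F -mulr_suml -mulrBl.
rewrite -(IH (S :\ h)); last 3 first.
- by rewrite -ltnS (leq_trans _ Sm) // ltnS [in leqRHS](cardsD1 h) hS.
- by rewrite !inE eq_sym hl.
- by rewrite setD11.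
rewrite (_ : _ - _ = 0) ?mul0r //; apply/eqP; rewrite subr_eq0; apply/eqP.
by apply: eq_bigr => k _; rewrite setD1C.
Qed.

(** [Wsum] obeys the same recursion for [id] and for [rpart], so the two differ only through [Dsum].
    Splitting off the least index of [S] reduces [Dsum] to a diagonal [pschur], which is already
    real. *)
Lemma Dsum_id S : Dsum M id S = quat_real (pminor S).
Proof.
suff: Dsum M id S = quat_real (pminor S) /\
  forall i j, j \notin S -> Wsum M id S i j = pschur S i j by case.
have [m] := ubnP #|S|; elim: m => // m IH in S * => Sm.
have DS : Dsum M id S = quat_real (pminor S).
  have [->|[l lS]] := set_0Vmem S; first by rewrite pminor0 Dsum0.
  case: (@arg_minnP _ l (mem S) (@nat_of_ord n) lS) => j /= jS jmin.
  rewrite -(setD1K jS) Dsum_min => [|x /setD1P[xj xS]]; last first.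
    by rewrite ltn_neqAle jmin // andbT eq_sym.
  rewrite (proj2 (IH (S :\ j) _)) ?pschur_diag ?setD11//.
  by rewrite -ltnS (leq_trans _ Sm) // ltnS [in leqRHS](cardsD1 j) jS.
split=> // i j jS; rewrite Wsum_rec // pschurr // DS; congr (_ - _).
apply: eq_bigr => k kS; rewrite (proj2 (IH (S :\ k) _)) //.
- by rewrite -ltnS (leq_trans _ Sm) // ltnS [in leqRHS](cardsD1 k) kS.
- by rewrite !inE negb_and jS orbT.
Qed.

Lemma moore_detE : moore_det M = pminor setT.
Proof. by rewrite /moore_det moore_sumE Dsum_id. Qed.

End Minors.

(** * The real representation *)

Section QuatMap.
Variables (K L : comNzRingType) (f : {rmorphism K -> L}).

Fact quat_map_zmod : zmod_morphism (quat_map f).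
Proof. by move=> x y; apply: quatE; rewrite /= rmorphB. Qed.
Fact quat_map_monoid : monoid_morphism (quat_map f).
Proof.
split=> [|x y]; first by apply: quatE; rewrite /= ?rmorph0 ?rmorph1.
by case: x; case: y => *; apply: quatE; rewrite /= ?(rmorphB, rmorphD, rmorphM).
Qed.
HB.instance Definition _ :=
  GRing.isZmodMorphism.Build (quat K) (quat L) (quat_map f) quat_map_zmod.
HB.instance Definition _ :=
  GRing.isMonoidMorphism.Build (quat K) (quat L) (quat_map f) quat_map_monoid.

Variables (n : nat) (M : 'M[quat K]_n).
Let fM := map_mx (quat_map f) M.

Lemma wordl_map l i : wordl fM l i = quat_map f (wordl M l i).
Proof. by elim: l => [|x l IH] /=; rewrite ?rmorph1// rmorphM IH mxE. Qed.

Lemma quat_map_real (a : K) : quat_map f (quat_real a) = quat_real (f a).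
Proof. by apply: quatE; rewrite /= ?rmorph0. Qed.

Lemma Dsum_map (u : quat K -> quat K) (v : quat L -> quat L) S :
    (forall x, v (quat_map f x) = quat_map f (u x)) ->
  Dsum fM v S = quat_map f (Dsum M u S).
Proof.
move=> uv; rewrite /Dsum rmorph_sum; apply: eq_bigr => s _ /=.
rewrite rmorphM rmorph_sign rmorph_prod; congr (_ * _); apply: eq_bigr => l _.
by rewrite /cycw wordl_map uv.
Qed.

Lemma pminor_map S : pminor fM S = f (pminor M S).
Proof.
rewrite /pminor (@Dsum_map (@rpart K)) // => x.
by rewrite /rpart quat_map_real.
Qed.

Lemma moore_det_map : moore_det fM = f (moore_det M).
Proof. by rewrite /moore_det !moore_sumE (@Dsum_map id). Qed.

End QuatMap.

Lemma pminor1 (K : comNzRingType) n S : pminor (1%:M : 'M[quat K]_n) S = 1.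
Proof.
have [m] := ubnP #|S|; elim: m => // m IH in S * => Sm.
have [->|[l lS]] := set_0Vmem S; first by rewrite pminor0.
rewrite -(setD1K lS) pminorU1 ?setD11// pschurr ?setD11// big1.
  rewrite subr0 mxE eqxx mulr1 /= IH //.
  by rewrite -ltnS (leq_trans _ Sm) // ltnS [in leqRHS](cardsD1 l) lS.
by move=> k; rewrite !inE => /andP[/negbTE kl _]; rewrite mxE kl mulr0.
Qed.

Section RealRep.
Variables (K : comNzRingType) (n : nat).
Implicit Types A B : 'M[quat K]_n.

Notation Are A := (map_mx (@qre K) A).
Notation Ai A := (map_mx (@qi K) A).
Notation Aj A := (map_mx (@qj K) A).
Notation Ak A := (map_mx (@qk K) A).

(* Left multiplication by a + b i + c j + d k in the real basis 1, i, j, k. *)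
Definition rmx A : 'M[K]_((n + n) + (n + n)) :=
  block_mx (block_mx (Are A) (- Ai A) (Ai A) (Are A))
           (block_mx (- Aj A) (- Ak A) (- Ak A) (Aj A))
           (block_mx (Aj A) (Ak A) (Ak A) (- Aj A))
           (block_mx (Are A) (- Ai A) (Ai A) (Are A)).

Lemma rmxM A B : rmx (A *m B) = rmx A *m rmx B.
Proof.
have sumE (g : quat K -> K) : g 0 = 0 -> {morph g : x y / x + y} ->
    forall F : 'I_n -> quat K, g (\sum_i F i) = \sum_i g (F i).
  by move=> g0 gD F; apply: (big_morph g gD g0).
have reM : Are (A *m B) = Are A *m Are B - Ai A *m Ai B - Aj A *m Aj B - Ak A
  *m Ak B.
  apply/matrixP => i j; rewrite !mxE sumE // -!sumrB; apply: eq_bigr => k _.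
  by rewrite !mxE; case: (A i k); case: (B k j).
have iM : Ai (A *m B) = Are A *m Ai B + Ai A *m Are B + Aj A *m Ak B - Ak A *m
  Aj B.
  apply/matrixP => i j; rewrite !mxE sumE // -!big_split -sumrB;
    apply: eq_bigr => k _.
  by rewrite !mxE; case: (A i k); case: (B k j).
have jM : Aj (A *m B) = Are A *m Aj B - Ai A *m Ak B + Aj A *m Are B + Ak A *m
  Ai B.
  apply/matrixP => i j; rewrite !mxE sumE // -sumrB -!big_split;
    apply: eq_bigr => k _.
  by rewrite !mxE; case: (A i k); case: (B k j).
have kM : Ak (A *m B) = Are A *m Ak B + Ai A *m Aj B - Aj A *m Ai B + Ak A *m
  Are B.
  apply/matrixP => i j; rewrite !mxE sumE // -!big_split -sumrB -big_split;
    apply: eq_bigr => k _.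
  by rewrite !mxE; case: (A i k); case: (B k j).
have addE (X Y : 'M[K]_n) i j : (X + Y) i j = X i j + Y i j by rewrite mxE.
have oppE (X : 'M[K]_n) i j : (- X) i j = - X i j by rewrite mxE.
rewrite /rmx !mulmx_block !add_block_mx !(mulmxN, mulNmx) reM iM jM kM.
by congr block_mx; congr block_mx; apply/matrixP => i j;
  rewrite !(addE, oppE); ring.
Qed.

Lemma rmx_adj A : rmx (adjmx A) = (rmx A)^T.
Proof.
rewrite /rmx !tr_block_mx.
by congr block_mx; congr block_mx; apply/matrixP => i j; rewrite !mxE ?opprK.
Qed.

Lemma rmxD A B : rmx (A + B) = rmx A + rmx B.
Proof.
rewrite /rmx !add_block_mx.
by congr block_mx; congr block_mx; apply/matrixP => i j; rewrite !mxE ?opprD.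
Qed.

Lemma rmx_diag (g : 'rV[K]_n) : rmx (diag_mx (map_mx (@quat_real K) g)) =
  block_mx (block_mx (diag_mx g) 0 0 (diag_mx g)) 0 0
           (block_mx (diag_mx g) 0 0 (diag_mx g)).
Proof.
rewrite /rmx -(@block_mx0 K n n n n).
by congr block_mx; congr block_mx; apply/matrixP => i j; rewrite !mxE;
  case: (i == j); rewrite //= ?oppr0.
Qed.

Definition rdet A : K := \det (rmx A).

Lemma rdetM A B : rdet (A *m B) = rdet A * rdet B.
Proof. by rewrite /rdet rmxM det_mulmx. Qed.

Lemma rdet_diag (g : 'rV[K]_n) :
  rdet (diag_mx (map_mx (@quat_real K) g)) = (\prod_i g 0 i) ^+ 4.
Proof.
by rewrite /rdet rmx_diag det_ublock !det_ublock !det_diag -!expr2 -exprM.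
Qed.

Lemma rmx_scalar a : rmx (quat_real a)%:M = a%:M.
Proof.
rewrite -diag_const_mx -map_const_mx rmx_diag diag_const_mx.
by rewrite -!scalar_mx_block.
Qed.

Lemma rdet1 : rdet 1%:M = 1.
Proof. by rewrite /rdet (rmx_scalar 1) det1. Qed.

End RealRep.

Lemma rmx_map (K L : comNzRingType) n (f : {rmorphism K -> L}) (A : 'M[quat
  K]_n) :
  rmx (map_mx (quat_map f) A) = map_mx f (rmx A).
Proof.
rewrite /rmx !map_block_mx.
by congr block_mx; congr block_mx; apply/matrixP => i j; rewrite !mxE ?rmorphN.
Qed.

Lemma rdet_map (K L : comNzRingType) n (f : {rmorphism K -> L}) (A : 'M[quat
  K]_n) :
  rdet (map_mx (quat_map f) A) = f (rdet A).
Proof. by rewrite /rdet rmx_map det_map_mx. Qed.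

(** * Gaussian elimination in the real representation *)

Section Elimination.
Variables (K : idomainType) (n : nat).
Hypothesis two_neq0 : (2 : K) != 0.

Lemma addrr_eq0 (x : K) : x + x = 0 -> x = 0.
Proof.
by move/eqP; rewrite -mulr2n -mulr_natr mulf_eq0 (negbTE two_neq0) orbF => /eqP.
Qed.

Local Notation dgq g := (diag_mx (map_mx (@quat_real K) g)).

(* Conjugation by a diagonal matrix turns 1 + N into 1 + 2 N = (1 + N)^2. *)
Lemma rdet_unipotent (N : 'M[quat K]_n) (g : 'rV[K]_n) :
    N *m N = 0 -> (forall i, g 0 i != 0) ->
    (forall i j, N i j * quat_real (g 0 j) = quat_real (g 0 i) * N i j *+ 2) ->
  rdet (1%:M + N) = 1.
Proof.
move=> N2 g0 Ng.
have sq : (1%:M + N) *m (1%:M + N) = 1%:M + N *+ 2.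
  by rewrite mulmxDl mul1mx mulmxDr mulmx1 N2 addr0 -addrA mulr2n.
have inv : (1%:M + N) *m (1%:M - N) = 1%:M.
  by rewrite mulmxDl mul1mx mulmxBr mulmx1 N2 subr0 subrK.
have conj : (1%:M + N) *m dgq g = dgq g *m (1%:M + N *+ 2).
  rewrite mulmxDl mulmxDr mul1mx mulmx1; congr (_ + _).
  apply/matrixP => i j; rewrite mul_mx_diag mul_diag_mx !mxE Ng.
  by rewrite mulr2n mulrDr.
have dg0 : rdet (dgq g) != 0.
  by rewrite rdet_diag expf_neq0 //; apply/prodf_neq0 => i _.
have d0 : rdet (1%:M + N) != 0.
  by apply: contra_eq_neq (congr1 (@rdet _ _) inv) => d;
    rewrite rdetM d mul0r rdet1 eq_sym oner_eq0.
move: (congr1 (@rdet _ _) conj); rewrite -sq !rdetM mulrC => /(mulfI dg0).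
by rewrite -[LHS]mulr1 => /(mulfI d0).
Qed.

Variable M : 'M[quat K]_n.
Hypothesis hM : hyperhermitian M.
Implicit Types S : {set 'I_n}.

(** Padding with the identity gives all principal submatrices the same size, so elimination steps
    are products of [n] by [n] matrices. *)
Definition submx1 S : 'M[quat K]_n :=
  \matrix_(a, b) if (a \in S) && (b \in S) then M a b else (a == b)%:R.

Definition spike (i : 'I_n) (d : K) : 'rV[K]_n := \row_k if k == i then d else
  1.

Lemma rdet_spike i d : rdet (dgq (spike i d)) = d ^+ 4.
Proof.
rewrite rdet_diag (bigD1 i) //= mxE eqxx big1 ?mulr1 // => k /negbTE ki.
by rewrite mxE ki.
Qed.

(** Multiply column [i] by [pminor M S] and subtract the Cramer combination of the columns in [S]
    (this is [N1]). The column vanishes except at [i], where [pschurl] leaves [pminor M (i |: S)].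
    The same matrix arises from [submx1 S] by filling in row [i] (this is [N2]) and scaling column
    [i]. Each scaling counts with its fourth power, and the cross-multiplied form avoids
    division. *)
Lemma rdet_submx1 S i : i \notin S ->
  rdet (submx1 (i |: S)) * pminor M S ^+ 4 =
  rdet (submx1 S) * pminor M (i |: S) ^+ 4.
Proof.
move=> iS; have reg := addrr_eq0.
pose N1 : 'M[quat K]_n := \matrix_(a, b)
  if (b == i) && (a \in S) then - pschur M (S :\ a) i a else 0.
pose N2 : 'M[quat K]_n := \matrix_(a, b)
  if (a == i) && (b \in S) then M i b else 0.
have aSi a : a \in S -> (a == i) = false.
  by move=> aS; apply: contraNF iS => /eqP<-.
have U1 : rdet (1%:M + N1) = 1.
  apply: (@rdet_unipotent _ (spike i 2)).
  - apply/matrixP => a b; rewrite !mxE big1 // => c _; rewrite !mxE.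
    case: (boolP (c == i)) => [/eqP->|_]; last by rewrite mul0r.
    by rewrite (negbTE iS) andbF mulr0.
  - by move=> k; rewrite mxE; case: ifP; rewrite ?oner_eq0.
  - move=> a b; rewrite [N1 a b]mxE; case: (eqVneq b i) => [->|_] /=;
    last by rewrite mul0r mulr0 mul0rn.
    case: ifP => aS; last by rewrite mul0r mulr0 mul0rn.
    by rewrite !mxE eqxx (aSi a) // rmorph_nat rmorph1 mul1r mulr_natr.
have U2 : rdet (1%:M + N2) = 1.
  (* [N1] lives in column [i], so its weight 2 sat at [i]; [N2] lives in row [i], so the weight 2
     belongs to the other indices. *)
  apply: (@rdet_unipotent _ (\row_k if k == i then 1 else 2)).
  - apply/matrixP => a b; rewrite !mxE big1 // => c _; rewrite !mxE.
    case: (boolP (c == i)) => [/eqP->|_]; last by rewrite mulr0.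
    by rewrite (negbTE iS) andbF mul0r.
  - by move=> k; rewrite mxE; case: ifP; rewrite ?oner_eq0.
  - move=> a b; rewrite [N2 a b]mxE; case: (eqVneq a i) => [->|_] /=;
    last by rewrite mul0r mulr0 mul0rn.
    case: ifP => bS; last by rewrite mul0r mulr0 mul0rn.
    by rewrite !mxE eqxx (aSi b) // rmorph_nat rmorph1 mul1r mulr_natr.
rewrite -(rdet_spike i (pminor M S)) -(rdet_spike i (pminor M (i |: S))).
rewrite -[X in _ * X = _]mulr1 -[X in _ = _ * X]mul1r -{1}U1 -U2 -!rdetM.
congr rdet; rewrite mulmxDr mulmxDl mul1mx mulmx1 !mulmxDr.
apply/matrixP => a b.
rewrite [LHS]mxE [RHS]mxE !mulmxA !mul_mx_diag ![(\matrix_(_,_) _) _ _]mxE.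
rewrite [(_ *m N1) a b]mxE [(_ *m N2) a b]mxE.
have -> : \sum_j (submx1 S) a j * N2 j b = (a == i)%:R * N2 i b.
  rewrite (bigD1 i) //= [submx1 _ _ _]mxE (negbTE iS) andbF big1 ?addr0 // => c
    /negbTE ci.
  by rewrite [N2 _ _]mxE ci mulr0.
have -> : \sum_j (\matrix_(i0, j0) (submx1 (i |: S) i0 j0 *
      (map_mx (@quat_real K) (spike i (pminor M S))) 0 j0)) a j * N1 j b =
    - (b == i)%:R * (if a \in i |: S then
    \sum_(c in S) M a c * pschur M (S :\ c) i c else 0).
  have [->|bi] := eqVneq b i; last first.
    by rewrite oppr0 mul0r big1 // => c _;
      rewrite [N1 _ _]mxE (negbTE bi) mulr0.
  rewrite mulN1r [RHS]fun_if oppr0 -sumrN [in RHS]big_mkcond /=.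
  case: ifP => aS; last first.
    apply: big1 => c _; rewrite [N1 _ _]mxE eqxx /=; case: ifP => cS;
      last by rewrite mulr0.
    rewrite !mxE aS /= (_ : (a == c) = false) ?mul0r //.
    by apply: contraFF aS => /eqP->; rewrite inE cS orbT.
  apply: eq_bigr => c _; rewrite [N1 _ _]mxE eqxx /=; case: ifP => cS;
    last by rewrite mulr0.
  by rewrite !mxE aS (setU1r _ cS) (aSi c) // rmorph1 mulr1 mulrN.
rewrite !mxE !inE eqxx; have [->|bi] := eqVneq b i.
  rewrite (negbTE iS) /= !andbF andbT mulr0 mul0r addr0 mulr1n mulN1r.
  have [->|ai] := eqVneq a i => /=.
    by rewrite -pschur_diag // pschurl // mul1r.
  case aS: (a \in S) => /=; first by rewrite pschur_cramer // subrr mul0r.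
  by rewrite subr0 !mul0r.
rewrite /= mulr0n oppr0 mul0r addr0 rmorph1 !mulr1.
have [->|ai] := eqVneq a i => /=; last by rewrite mul0r addr0.
rewrite (negbTE iS) /= mul1r eq_sym (negbTE bi); case: ifP => _.
  by rewrite add0r.
by rewrite addr0.
Qed.

Lemma rdet_pminor : (forall S, pminor M S != 0) -> rdet M = moore_det M ^+ 4.
Proof.
move=> D0; rewrite moore_detE //; last exact: addrr_eq0.
suff H S : rdet (submx1 S) = pminor M S ^+ 4.
  by rewrite -H; congr rdet; apply/matrixP => a b; rewrite mxE !inE.
have [m] := ubnP #|S|; elim: m => // m IH in S * => Sm.
have [->|[i iS]] := set_0Vmem S.
  rewrite pminor0 expr1n; rewrite -[RHS](rdet1 K n); congr rdet.
  by apply/matrixP => a b; rewrite !mxE inE.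
apply: (mulIf (expf_neq0 4 (D0 (S :\ i)))).
rewrite -{1 3}(setD1K iS) rdet_submx1 ?setD11// IH; first by rewrite mulrC.
by rewrite -ltnS (leq_trans _ Sm) // ltnS [in leqRHS](cardsD1 i) iS.
Qed.

End Elimination.

Section MooreDet4.
Variables (K : idomainType) (n : nat).
Hypothesis two_neq0 : (2 : K) != 0.

(* On the segment A + X (I - A) the principal minors are polynomials in X with
   value 1 at X = 1, so none of them vanishes. *)
Lemma moore_det4 (A : 'M[quat K]_n) : hyperhermitian A ->
  rdet A = moore_det A ^+ 4.
Proof.
move=> hA; pose q := quat_map (@polyC K).
pose P : 'M[quat {poly K}]_n :=
  map_mx q A + (quat_real 'X)%:M *m map_mx q (1%:M - A).
have quat_hornerX x : quat_map (horner_eval x) (quat_real 'X) = quat_real x.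
  by rewrite quat_map_real /= /horner_eval hornerX.
have quat_hornerC x y : quat_map (horner_eval x) (q y) = y.
  by case: y => *; apply: quatE; rewrite /= /horner_eval hornerC.
have PE x : map_mx (quat_map (horner_eval x)) P =
    A + (quat_real x)%:M *m (1%:M - A).
  apply/matrixP => i j; rewrite /P !mul_scalar_mx !mxE rmorphD rmorphM /=.
  by rewrite quat_hornerX !quat_hornerC.
have P0 : map_mx (quat_map (horner_eval 0)) P = A.
  by rewrite PE rmorph0 mul0mx addr0.
have P1 : map_mx (quat_map (horner_eval 1)) P = 1%:M.
  by rewrite PE rmorph1 mul1mx addrC subrK.
rewrite -P0 rdet_map moore_det_map -rmorphXn; congr (_ _).
apply: rdet_pminor => [||S].
- by rewrite -polyC_natr polyC_eq0.
- apply/matrixP => i j; rewrite /P !mul_scalar_mx !mxE raddfD /= quat_conjM.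
  have hC a : quat_conj (q a) = q (quat_conj a).
    by apply: quatE; rewrite //= polyCN.
  rewrite quat_conj_real -quat_realC !hC raddfB /= !(hyperhermitianE hA).
  congr (_ + _ * q (_ - _)); rewrite eq_sym; case: (_ == _) => /=.
    exact/esym/quat_conj_real.
  exact/esym/(quat_conj_real (0 : K)).
- apply: contra_eq_neq (pminor1 K S) => PS0.
  by rewrite -P1 pminor_map PS0 rmorph0 eq_sym oner_eq0.
Qed.

End MooreDet4.

From mathcomp Require Import boolp classical_sets reals exp mpoly.
Import ComplexField.Normc.

(** * Hyperbolic polynomials *)

Section MultivariateMaps.
Variables (k : nat) (R : comNzRingType) (B : comNzRingType).
Variables (f : {rmorphism R -> B}) (h : 'I_k -> B).
Implicit Types p q : {mpoly R[k]}.

Lemma rmorph_mmap (B' : comNzRingType) (g : {rmorphism B -> B'}) p :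
  g (mmap f h p) = mmap (g \o f) (g \o h) p.
Proof.
rewrite /mmap rmorph_sum; apply: eq_bigr => m _; rewrite rmorphM rmorph_prod.
by congr (_ * _); apply: eq_bigr => i _; rewrite rmorphXn.
Qed.

(** The chain rule for an abstract derivation covers both the derivative along a line and the
    partial derivatives after merging variables. *)
Lemma mmap_chain (d : {additive B -> B}) p :
    (forall x y, d (x * y) = d x * y + x * d y) -> (forall c, d (f c) = 0) ->
  d (mmap f h p) = \sum_i mmap f h p^`M(i) * d (h i).
Proof.
move=> dM df.
have PM q r : d (mmap f h q) = \sum_i mmap f h q^`M(i) * d (h i) ->
    d (mmap f h r) = \sum_i mmap f h r^`M(i) * d (h i) ->
    d (mmap f h (q * r)) = \sum_i mmap f h (q * r)^`M(i) * d (h i).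
  move=> dq dr; rewrite rmorphM dM dq dr mulr_suml mulr_sumr -big_split.
  by apply: eq_bigr => i _; rewrite mderivM rmorphD !rmorphM /=; ring.
have P1 : d (mmap f h 1) = \sum_i mmap f h 1^`M(i) * d (h i).
  rewrite -mpolyC1 mmapC df big1 // => i _.
  by rewrite mderivC rmorph0 mul0r.
elim/mpolyind: p => [|c m p _ _ IH].
  by rewrite !raddf0 big1 // => i _; rewrite raddf0 raddf0 mul0r.
rewrite rmorphD raddfD IH.
under [RHS]eq_bigr do rewrite mderivD rmorphD mulrDl.
rewrite big_split; congr (_ + _); rewrite -mul_mpolyC; apply: (PM).
  by rewrite mmapC df big1 // => i _; rewrite mderivC rmorph0 mul0r.
rewrite mpolyXE_id; apply: (big_ind (fun q => d (mmap f h q) = \sum_i mmap f h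
  q^`M(i) * d (h i))).
- exact: P1.
- exact: PM.
move=> i _; elim: (m i) => [|e IHe]; first by rewrite expr0.
rewrite exprS; apply: PM IHe.
rewrite mmapX mmap1U (bigD1 i) //= mderivX mnm1E eqxx scale1r.
rewrite big1 ?addr0 => [|j ji].
  rewrite (_ : (U_(i) - U_(i))%MM = 0%MM);
    first by rewrite mpolyX0 rmorph1 mul1r.
  by apply/mnmP => l; rewrite mnmBE mnm0E subnn.
by rewrite mderivX mnm1E eq_sym (negbTE ji) scale0r rmorph0 mul0r.
Qed.

End MultivariateMaps.

Section LineTop.
Variables (k : nat) (R : comNzRingType) (B : comNzRingType).
Variables (f : {rmorphism R -> B}) (c w : 'I_k -> B).

(** Since [a] may be zero, this is stable under products over any commutative ring, unlike a
    statement on exact degrees. *)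
Let top (p : {poly B}) d a := (size p <= d.+1)%N /\ p`_d = a.

Let topM p q d e a b : top p d a -> top q e b -> top (p * q) (d + e) (a * b).
Proof.
move=> [sp pa] [sq qb]; split.
  apply: leq_trans (size_polyMleq _ _) _.
  by rewrite -subn1 leq_subLR add1n -addSn -addnS leq_add.
rewrite coefM (bigD1 (inord d)) //= inordK ?ltnS ?leq_addr// addKn pa qb.
rewrite big1 ?addr0 // => i; rewrite -val_eqE /= inordK ?ltnS ?leq_addr// => id.
case: (ltngtP i d) id => // idl _.
  by rewrite [q`_ _]nth_default ?mulr0 // (leq_trans sq) // ltn_subRL ltn_add2r.
by rewrite nth_default ?mul0r // (leq_trans sp).
Qed.

Lemma mmap_line_top (p : {mpoly R[k]}) d : p \is d.-homog ->
  let P := mmap (polyC \o f) (fun i => (c i)%:P + (w i)%:P * 'X) p in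
  (size P <= d.+1)%N /\ P`_d = mmap f w p.
Proof.
move=> pd /=; pose h i := (c i)%:P + (w i)%:P * 'X.
rewrite -/h; change (top (mmap (polyC \o f) h p) d (mmap f w p)).
have toph i : top (h i) 1 (w i).
  rewrite /top /h addrC; split.
    by rewrite size_MXaddC; case: ifP => // _; rewrite ltnS size_polyC leq_b1.
  by rewrite coefD coefMX !coefC /= addr0.
have topX i e : top (h i ^+ e) e (w i ^+ e).
  elim: e => [|e IH]; last by rewrite !exprS -add1n; apply: topM.
  by rewrite /top !expr0 coef1 size_poly1.
have top1 m : top (mmap1 h m) (mdeg m) (mmap1 w m).
  rewrite mdegE /mmap1; elim/big_rec3: _ => [|i x y z _]; last exact/topM.
  by rewrite /top coef1 size_poly1.
have topf (x : R) : top (f x)%:P 0 (f x).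
  by rewrite /top coefC size_polyC leq_b1.
rewrite /mmap [X in top X _ _]big_seq [X in top _ _ X]big_seq.
elim/big_rec2: _ => [|m x y mp [sy yx]]; first by rewrite /top size_poly0 coef0.
have := topM (topf p@_m) (top1 m); rewrite add0n (dhomog_mf pd mp) => -[s1 t1].
by split; [rewrite (leq_trans (size_polyD _ _)) // geq_max s1|rewrite coefD t1
  yx].
Qed.

End LineTop.

(** * Roots in a half plane and their behaviour along a homotopy *)

Section ComplexRoots.
Local Open Scope complex_scope.
Variable R : realType.
Local Notation C := R[i].
Local Notation Re := complex.Re.
Local Notation Im := complex.Im.
Implicit Types (p q : {poly C}) (z t : C).

Lemma normc_prod (I : Type) (r : seq I) (F : I -> C) :
  normc (\prod_(i <- r) F i) = \prod_(i <- r) normc (F i).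
Proof. by apply: big_morph; [exact: normcM|exact: normc1]. Qed.

Lemma normcX z k : normc (z ^+ k) = normc z ^+ k.
Proof. by elim: k => [|k IH]; rewrite ?expr0 ?normc1// !exprS normcM IH. Qed.

Lemma normc_ge0 z : 0 <= normc z.
Proof. by case: z => a b; exact: sqrtr_ge0. Qed.

Lemma normc_real (x : R) : normc x%:C = `|x|.
Proof. by rewrite /= expr0n addr0 sqrtr_sqr. Qed.

Lemma normc_gt0 z : z != 0 -> 0 < normc z.
Proof.
by move=> z0; rewrite lt_neqAle normc_ge0 eq_sym andbT;
  apply: contraNneq z0 => /eq0_normc->.
Qed.

Lemma normc_ge_Im z : `|Im z| <= normc z.
Proof.
case: z => a b /=; rewrite -[X in X <= _]sqrtr_sqr ler_wsqrtr //.
by rewrite lerDr sqr_ge0.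
Qed.

Lemma normc_sum (I : Type) (r : seq I) (F : I -> C) :
  normc (\sum_(i <- r) F i) <= \sum_(i <- r) normc (F i).
Proof.
elim: r => [|i r IH]; rewrite ?big_nil ?normc0// !big_cons.
by apply: le_trans (le_normcD _ _) _; rewrite lerD2l.
Qed.

(** The bound on [p.[x]] is carried along for the product rule in the induction. The unit disc
    suffices, as the arguments will be homotopy parameters or small shifts. *)
Lemma poly_lipschitz p : exists2 K : R, 0 <= K & forall x y : C,
  normc x <= 1 -> normc y <= 1 ->
  normc p.[x] <= K /\ normc (p.[x] - p.[y]) <= K * normc (x - y).
Proof.
elim/poly_ind: p => [|p c [K K0 IH]].
  by exists 0 => // x y _ _; rewrite !horner0 subrr normc0 mul0r.
exists (K + K + normc c); first by rewrite !addr_ge0 ?normc_ge0.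
move=> x y x1 y1; have [px pxy] := IH x y x1 y1; rewrite !hornerE.
have nc := normc_ge0 c; have nx := normc_ge0 (x - y); split.
  apply: le_trans (le_normcD _ _) _; rewrite lerD2r normcM.
  have : normc p.[x] * normc x <= K * 1 by rewrite ler_pM ?normc_ge0.
  by lra.
rewrite (_ : _ - _ = p.[x] * (x - y) + (p.[x] - p.[y]) * y); last by ring.
apply: le_trans (le_normcD _ _) _; rewrite !normcM.
have : normc p.[x] * normc (x - y) <= K * normc (x - y) by rewrite ler_wpM2r.
have : normc (p.[x] - p.[y]) * normc y <= K * normc (x - y) * 1.
  by rewrite ler_pM ?normc_ge0.
have : 0 <= normc c * normc (x - y) by rewrite mulr_ge0.
by lra.
Qed.

Definition lower_roots p := forall z, root p z -> Im z < 0.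

Lemma lower_roots_factor p d c : c != 0 -> (size p <= d.+1)%N -> p`_d = c ->
  lower_roots p -> exists2 r : seq C, p = c *: \prod_(z <- r) ('X - z%:P) &
    size r = d /\ {in r, forall z, Im z < 0}.
Proof.
move=> c0 sp pd lp; have [r pr] := closed_field_poly_normal p.
have sz : size p = d.+1.
  apply/eqP; rewrite eqn_leq sp ltnNge; apply: contraNN c0 => ps.
  by rewrite -pd nth_default.
have lc : lead_coef p = c by rewrite lead_coefE sz.
rewrite lc in pr; exists r => //; split.
  by move: sz; rewrite pr size_scale// size_prod_XsubC => -[].
move=> z zr; apply: lp; rewrite pr rootZ// root_prod_XsubC//.
Qed.

(** The growth factor makes the bound uniform on the unbounded closed half plane: it dominates a
    small change of the coefficients for all [t] at once. *)
Lemma lower_roots_bound p d c : c != 0 -> (size p <= d.+1)%N -> p`_d = c ->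
  lower_roots p -> exists2 k : R, 0 < k &
    forall t, 0 <= Im t -> k * (1 + normc t) ^+ d <= normc p.[t].
Proof.
move=> c0 sp pd lp; have [r -> [<- rneg]] := lower_roots_factor c0 sp pd lp.
suff [k k0 hk] : exists2 k : R, 0 < k & forall t, 0 <= Im t ->
    k * (1 + normc t) ^+ size r <= \prod_(z <- r) normc (t - z).
  exists (normc c * k) => [|t It]; first by rewrite mulr_gt0 ?normc_gt0.
  rewrite hornerZ normcM -mulrA ler_wpM2l ?normc_ge0//.
  apply: le_trans (hk t It) _; rewrite horner_prod normc_prod.
  by under [leRHS]eq_bigr do rewrite hornerXsubC.
elim: r rneg {pd sp lp} => [|z r IH] rneg.
  by exists 1 => // t _; rewrite big_nil mulr1.
have [k k0 hk] := IH (fun y yr => rneg y (mem_behead (s := z :: r) yr)).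
have Iz : Im z < 0 by rewrite rneg ?mem_head.
have nz := normc_ge0 z.
(* From [|t| <= |t - z| + |z|] and [- Im z <= |t - z|] one gets [1 + |t| <= b |t - z|]. *)
pose b := (1 + normc z) / - Im z + 1.
have b0 : 0 < b by rewrite ltr_wpDl// divr_ge0; lra.
exists (b^-1 * k) => [|t It]; first by rewrite mulr_gt0 ?invr_gt0.
rewrite big_cons exprS mulrACA; apply: ler_pM.
- by rewrite mulr_ge0 ?invr_ge0 ?(ltW b0)// addr_ge0 ?normc_ge0 ?ler01.
- by rewrite mulr_ge0 ?(ltW k0)// exprn_ge0 ?addr_ge0 ?normc_ge0 ?ler01.
- rewrite ler_pdivrMl//.
  have h1 : normc t <= normc (t - z) + normc z by rewrite -{1}(subrK z t)
    le_normcD.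
  have h2 : - Im z <= normc (t - z).
    apply: le_trans (normc_ge_Im _); rewrite raddfB /=.
    by apply: le_trans (ler_norm _); lra.
  have h3 : (1 + normc z) <= (1 + normc z) / - Im z * normc (t - z).
    by rewrite mulrAC ler_pdivlMr; [rewrite ler_wpM2l//; lra|lra].
  by rewrite /b mulrDl mul1r; lra.
- exact: hk.
Qed.

(** This bound depends on [c] and [d] but not on the roots, so it is uniform along a homotopy with
    fixed leading coefficient. *)
Lemma lower_roots_Im_bound p d c : c != 0 -> (size p <= d.+1)%N -> p`_d = c ->
  lower_roots p -> forall t, 0 <= Im t -> normc c * Im t ^+ d <= normc p.[t].
Proof.
move=> c0 sp pd lp t It;
  have [r -> [<- rneg]] := lower_roots_factor c0 sp pd lp.
rewrite hornerZ normcM ler_wpM2l ?normc_ge0// horner_prod normc_prod.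
elim: r rneg {pd sp lp} => [|z r IH] rneg; first by rewrite big_nil.
rewrite big_cons exprS; apply: ler_pM => //; first exact: exprn_ge0.
  rewrite hornerXsubC; apply: le_trans (normc_ge_Im _); rewrite raddfB /=.
  by apply: le_trans (ler_norm _); have := rneg z (mem_head _ _); lra.
by apply: IH => y yr; rewrite rneg // mem_behead.
Qed.

(** Connectedness of the unit interval: consider the supremum of the [s] such that [P] holds on all
    of [[0, s]]. *)
Lemma segment_ind (P : R -> Prop) : P 0 ->
  (forall s : R, 0 <= s <= 1 -> P s ->
    exists2 e : R, 0 < e & forall t : R, 0 <= t <= 1 -> `|t - s| < e -> P t) ->
  (forall s : R, 0 <= s <= 1 -> ~ P s ->
    exists2 e : R, 0 < e & forall t : R, 0 <= t <= 1 -> `|t - s| < e -> ~ P t)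
      ->
  P 1.
Proof.
move=> P0 Po Pc.
pose S : set R := fun s : R => 0 <= s <= 1 /\ forall t : R, 0 <= t <= s -> P t.
have S0 : S 0.
  split; first by rewrite lexx ler01.
  by move=> t /andP[t0 t1]; rewrite (_ : t = 0) //; apply/le_anti/andP.
have Sub : has_sup S.
  by split; [exists 0|exists 1 => s [/andP[]]].
set u := sup S.
have u0 : 0 <= u by apply: sup_upper_bound.
have u1 : u <= 1 by apply: ge_sup; [exists 0|move=> s [/andP[]]].
have below (t : R) : 0 <= t -> t < u -> P t.
  move=> t0 tu; have [|s [_ sP] ts] := sup_adherent (_ : 0 < u - t) Sub.
    by rewrite subr_gt0.
  by apply: sP; rewrite t0 /=; move: ts; rewrite -/u; lra.
have Pu : P u.
  apply/asboolP/negPn/negP => /asboolP nPu.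
  have u01 : 0 <= u <= 1 by rewrite u0.
  have [e e0 he] := Pc u u01 nPu.
  have [s Ss us] := sup_adherent e0 Sub; case: (Ss) => s01 sP.
  have su : s <= u by apply: sup_upper_bound.
  apply: (he s s01); last by apply: sP; rewrite lexx; case/andP: s01 => ->.
  by rewrite ler0_norm ?subr_le0//; move: us; rewrite -/u; lra.
have [->//|un1] := eqVneq 1 u.
have u01 : 0 <= u <= 1 by rewrite u0.
have [e e0 he] := Po u u01 Pu.
pose v := Num.min 1 (u + e / 2).
have uv : u < v by rewrite lt_min lt_neqAle eq_sym un1 u1 /=; lra.
suff Sv : S v by have := sup_upper_bound Sub Sv; rewrite -/u leNgt uv.
have v1 : v <= 1 by rewrite ge_min lexx.
have ve : v <= u + e / 2 by rewrite ge_min lexx orbT.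
split; first by rewrite v1; lra.
move=> t /andP[t0 tv]; have [tu|ut] := ltP t u; first exact: below.
by apply: he; [rewrite t0 /=; lra|rewrite ger0_norm ?subr_ge0//; lra].
Qed.

(** The constant leading coefficient keeps roots from escaping to infinity, and the absence of real
    roots keeps them from crossing the axis. Openness comes from [lower_roots_bound]. For
    closedness, a root [z] of [g s] outside the lower half plane has [Im z > 0], and then
    [lower_roots_Im_bound] keeps [(g t).[z]] away from zero for every good [t]. *)
Lemma lower_roots_homotopy (Phi : {poly {poly C}}) d (c : C)
    (g := fun s : R => map_poly (horner_eval s%:C) Phi) :
  c != 0 -> (size Phi <= d.+1)%N -> Phi`_d = c%:P ->
  (forall s x : R, 0 <= s <= 1 -> (g s).[x%:C] != 0) ->
  lower_roots (g 0) -> lower_roots (g 1).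
Proof.
move=> c0 sP Pd gr g0.
have sg s : (size (g s) <= d.+1)%N by apply: leq_trans (size_poly _ _) sP.
have gd s : (g s)`_d = c by rewrite coef_map /= Pd /horner_eval hornerC.
have [K K0 lipK] : exists2 K : R, 0 <= K & forall (s t : R) z,
    0 <= s <= 1 -> 0 <= t <= 1 ->
    normc ((g s).[z] - (g t).[z]) <= K * `|s - t| * (1 + normc z) ^+ d.
  have /choice[K hK] : forall i : 'I_d.+1, exists K : R, 0 <= K /\
      forall s t : R, 0 <= s <= 1 -> 0 <= t <= 1 ->
      normc ((Phi`_i).[s%:C] - (Phi`_i).[t%:C]) <= K * `|s - t|.
    move=> i; have [K K0 hK] := poly_lipschitz (Phi`_i); exists K;
      split=> // s t s1 t1.
    have -> : `|s - t| = normc (s%:C - t%:C) by rewrite -rmorphB normc_real.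
    by apply: (hK _ _ _ _).2; rewrite normc_real ger0_norm; lra.
  exists (\sum_i K i) => [|s t z s1 t1]; first by apply: sumr_ge0 => i _;
    case: (hK i).
  rewrite !(horner_coef_wide _ (sg _)) -sumrB.
  apply: le_trans (normc_sum _ _) _; rewrite !mulr_suml; apply: ler_sum => i _.
  rewrite -mulrBl normcM; apply: ler_pM; rewrite ?normc_ge0//.
    by rewrite !coef_map; apply: (hK i).2.
  rewrite normcX; apply: (@le_trans _ _ ((1 + normc z) ^+ i)).
    by rewrite lerXn2r ?nnegrE ?addr_ge0 ?normc_ge0// lerDr ler01.
  by apply: ler_weXn2l; rewrite ?lerDl ?normc_ge0// -ltnS ltn_ord.
apply: (@segment_ind (fun s => lower_roots (g s))) => // s s01 hs.
  have [k k0 hk] := lower_roots_bound c0 (sg s) (gd s) hs.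
  (* The [+ 1] covers the case [K = 0]. *)
  exists (k / (K + 1)) => [|t t01 ts z /rootP gz];
    first by rewrite divr_gt0//; lra.
  rewrite ltNge; apply/negP => Iz.
  have := hk z Iz; have := lipK s t z s01 t01; rewrite gz subr0 => h1 h2.
  have := le_trans h2 h1; rewrite ler_pM2r; last first.
    by rewrite exprn_gt0 // ltr_wpDr ?normc_ge0.
  rewrite leNgt => /negP; apply; move: ts; rewrite ltr_pdivlMr; last by lra.
  rewrite distrC => h; apply: le_lt_trans h; rewrite mulrC ler_wpM2l//; lra.
have [z [gz Iz]] : exists z, root (g s) z /\ 0 < Im z.
  move/existsNP: hs => [z /not_implyP[gz /negP]]; rewrite -leNgt => Iz.
  exists z; split=> //; rewrite lt_neqAle Iz andbT; apply: contraTneq gz => Iz0.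
  by have := gr s (Re z) s01; case: z Iz Iz0 => a b /= _ <-.
have nz := normc_ge0 z.
pose B := K * (1 + normc z) ^+ d + 1.
have B0 : 0 < B by rewrite ltr_wpDl// mulr_ge0 // exprn_ge0 // addr_ge0.
exists (normc c * Im z ^+ d / B).
  by rewrite divr_gt0 // mulr_gt0 ?normc_gt0 ?exprn_gt0.
move=> t t01 ts lt.
have := lower_roots_Im_bound c0 (sg t) (gd t) lt (ltW Iz).
have := lipK t s z t01 s01; rewrite (rootP gz) subr0 => h1 h2.
have := le_trans h2 h1; rewrite leNgt => /negP; apply.
move: ts; rewrite ltr_pdivlMr // => h; apply: le_lt_trans h.
by rewrite -mulrA mulrCA ler_wpM2l// /B; lra.
Qed.

End ComplexRoots.

Section ComplexEvaluation.
Local Open Scope complex_scope.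
Variables (R : realType) (k : nat).
Local Notation C := R[i].
Local Notation Re := complex.Re.
Local Notation Im := complex.Im.
Local Notation toC := (map_mx (real_complex R)).
Implicit Types (F : {mpoly R[k]}) (z w : 'rV[C]_k) (x a e : 'rV[R]_k).

Definition cev F z : C := mmap (real_complex R) (z 0) F.

Lemma cev_real F x : cev F (toC x) = F.@[x 0]%:C.
Proof.
rewrite /meval (rmorph_mmap idfun (x 0) (real_complex R)) /cev /mmap.
apply: eq_bigr => m _; congr (_ * _); apply: eq_bigr => i _.
by rewrite mxE.
Qed.

Lemma cev_conj F z : cev F (map_mx (@conjc R) z) = (cev F z)^*.
Proof.
rewrite /cev (rmorph_mmap (real_complex R) (z 0) (@conjc R)) /mmap.
apply: eq_bigr => m _; congr (_ * _); first by rewrite /= oppr0.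
by apply: eq_bigr => i _; rewrite mxE.
Qed.

Definition cline F z w : {poly C} :=
  mmap (polyC \o real_complex R) (fun i => (z 0 i)%:P + (w 0 i)%:P * 'X) F.

Lemma horner_cline F z w t : (cline F z w).[t] = cev F (z + t *: w).
Proof.
rewrite -[LHS]/(horner_eval t _) rmorph_mmap /cev /mmap.
apply: eq_bigr => m _; congr (_ * _); first by rewrite /= /horner_eval hornerC.
apply: eq_bigr => i _; congr (_ ^+ _).
by rewrite /= /horner_eval !hornerE !mxE mulrC.
Qed.

Lemma cline_top F z w d : F \is d.-homog ->
  (size (cline F z w) <= d.+1)%N /\ (cline F z w)`_d = cev F w.
Proof. exact: mmap_line_top. Qed.

Lemma cev_homog F d c z : F \is d.-homog -> cev F (c *: z) = c ^+ d * cev F z.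
Proof.
move=> Fd; rewrite /cev /mmap mulr_sumr big_seq [RHS]big_seq.
apply: eq_bigr => m mF; rewrite mulrCA; congr (_ * _).
have <- : mdeg m = d := dhomog_mf Fd mF.
rewrite mdegE /mmap1 -prodrXr -big_split.
by apply: eq_bigr => i _; rewrite mxE exprMn.
Qed.

Lemma deriv_cline F z j :
  (cline F z (delta_mx 0 j))^`() = cline F^`M(j) z (delta_mx 0 j).
Proof.
rewrite /cline (@mmap_chain _ _ _ _ _ (@deriv C) F (@derivM C)) => [|c];
  last exact: derivC.
rewrite (bigD1 j) //= big1 ?addr0 => [|i ij].
  by rewrite derivD derivC add0r deriv_mulC derivX mxE !eqxx mulr1 mulr1.
by rewrite derivD derivC add0r deriv_mulC derivX mxE (negbTE ij) andbF mul0r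
  mulr0.
Qed.

Lemma cev_homotopy F d z z' w (c : C) :
  F \is d.-homog -> cev F w = c -> c != 0 ->
  (forall s x : R, 0 <= s <= 1 -> cev F (z + s%:C *: z' + x%:C *: w) != 0) ->
  (forall t : C, cev F (z + t *: w) = 0 -> Im t < 0) ->
  forall t : C, cev F (z + z' + t *: w) = 0 -> Im t < 0.
Proof.
move=> Fd Fw c0 nr r0.
pose f := (polyC : C -> {poly C}) \o real_complex R.
(* The inner variable is the homotopy parameter [s], the outer one is the root variable [t]. The
   coefficient of degree [d] in [t] is the value of [F] at [w], which is free of [s]. *)
pose u i := (z 0 i)%:P + (z' 0 i)%:P * 'X : {poly C}.
pose Phi := mmap (polyC \o f) (fun i => (u i)%:P + (w 0 i)%:P%:P * 'X) F.
have [sP Pd] : (size Phi <= d.+1)%N /\ Phi`_d = c%:P.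
  have [sP ->] := mmap_line_top f u (fun i => (w 0 i)%:P) Fd.
  split=> //; rewrite -Fw /cev (rmorph_mmap _ _ polyC) /mmap.
  by apply: eq_bigr => m _; congr (_ * _); apply: eq_bigr.
have PE (s t : C) : (map_poly (horner_eval s) Phi).[t] = cev F (z + s *: z' + t
  *: w).
  rewrite -[LHS]/(horner_eval t _).
  rewrite -[LHS]/((horner_eval t \o map_poly (horner_eval s)) Phi).
  rewrite rmorph_mmap /cev /mmap.
  apply: eq_bigr => m _; congr (_ * _).
    by rewrite /= map_polyC /horner_eval hornerC; exact: hornerC.
  apply: eq_bigr => i _; congr (_ ^+ _).
  rewrite /= rmorphD rmorphM /= !map_polyC map_polyX /= /horner_eval.
  by rewrite /u !hornerE !mxE (mulrC s) (mulrC t).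
have := @lower_roots_homotopy R Phi d c c0 sP Pd.
rewrite /lower_roots; move=> H t zt; apply: H.
- by move=> s x s01; rewrite PE nr.
- move=> y; rewrite /root PE rmorph0 scale0r addr0 => /eqP; exact: r0.
- by rewrite /root PE rmorph1 scale1r zt.
Qed.

End ComplexEvaluation.

(** * The cone of a hyperbolic polynomial and its convexity *)

Section Garding.
Local Open Scope complex_scope.
Variables (R : realType) (k d : nat).
Local Notation C := R[i].
Local Notation Re := complex.Re.
Local Notation Im := complex.Im.
Local Notation toC := (map_mx (real_complex R)).
Variables (F : {mpoly R[k]}) (e : 'rV[R]_k).
Hypothesis Fd : F \is d.-homog.
Hypothesis Fe : forall (x : 'rV[R]_k) (s : C), 0 < Im s ->
  cev F (toC x + s *: toC e) != 0.
Implicit Types (x a b : 'rV[R]_k) (s t : C).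

(** Garding's cone, in the ray form in which [Gamma] is given. *)
Definition hyp_cone a := forall r : R, 0 <= r -> F.@[(a + r *: e) 0] != 0.

Lemma cev_toC_neq0 a : (cev F (toC a) != 0) = (F.@[a 0] != 0).
Proof. by rewrite cev_real fmorph_eq0. Qed.

Lemma toC_addZ a (r : R) b : toC (a + r *: b) = toC a + r%:C *: toC b.
Proof. by rewrite map_mxD map_mxZ. Qed.

Lemma toC_conj a : map_mx (@conjc R) (toC a) = toC a.
Proof. by apply/matrixP => i j; rewrite !mxE conjc_real. Qed.

(** Hyperbolicity excludes [Im s > 0], conjugation then excludes [Im s < 0], and the cone condition
    excludes real [s >= 0]. *)
Lemma hyp_cone_dir a s : hyp_cone a -> cev F (toC a + s *: toC e) = 0 ->
  exists2 r : R, r < 0 & s = r%:C.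
Proof.
move=> ha sa.
have Is : Im s <= 0.
  by rewrite leNgt; apply/negP => /(Fe a); rewrite sa eqxx.
have Is' : 0 <= Im s.
  rewrite leNgt; apply/negP => Is0;
    have : 0 < Im (s^*) by case: s Is0 {sa Is} => u v /=; rewrite oppr_gt0.
  move/(Fe a); rewrite -{1}(toC_conj a) -{1}(toC_conj e) -map_mxZ -map_mxD.
  by rewrite cev_conj sa rmorph0 eqxx.
have Es : s = (Re s)%:C.
  by case: s {sa} Is Is' => u v /= v0 v0'; rewrite (@le_anti _ _ v 0) ?v0.
exists (Re s) => //; rewrite ltNge; apply/negP => /ha/negP; apply.
by rewrite -[_ == 0]negbK -cev_toC_neq0 toC_addZ -Es sa eqxx.
Qed.

(** By homogeneity [i y / t] is a root in the direction [e], hence a negative real, so [t] lies on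
    the negative imaginary axis. This is the starting point of the homotopies. *)
Lemma hyp_cone_lower a (y : R) t : hyp_cone a -> 0 < y ->
  cev F ((y%:C * 'i) *: toC e + t *: toC a) = 0 -> Im t < 0.
Proof.
move=> ha y0; have Iy : 0 < Im (y%:C * 'i) by rewrite ImiRe.
have [->|t0] := eqVneq t 0.
  rewrite scale0r addr0 => /eqP; have := Fe 0 Iy.
  by rewrite map_mx0 add0r => /negbTE->.
rewrite addrC -[X in _ + X *: _](mulVKf t0) -scalerA -scalerDr (cev_homog _ _
  Fd).
move/eqP; rewrite mulf_eq0 expf_eq0 (negbTE t0) andbF => /eqP.
case/(hyp_cone_dir ha) => r r0 tr.
have r0' : r%:C != 0 :> C by rewrite fmorph_eq0 lt_eqF.
have -> : t = (y * r^-1)%:C * 'i.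
  rewrite rmorphM fmorphV mulrAC; apply: (mulfI (invr_neq0 t0)).
  by rewrite mulVf // mulrA tr mulfV.
by rewrite ImiRe /= pmulr_rlt0 // invr_lt0.
Qed.

Lemma hyp_cone_open a : hyp_cone a -> exists2 u : R, 0 < u & hyp_cone (a - u *:
  e).
Proof.
move=> ha; pose p := cline F (toC a) (toC e).
have pE (r : R) : p.[r%:C] = cev F (toC (a + r *: e)).
  by rewrite horner_cline toC_addZ.
have [K K0 lipK] := poly_lipschitz p.
have p0 : 0 < normc p.[0].
  by apply: normc_gt0; rewrite -[0]/(0%:C) pE cev_toC_neq0 ha.
(* Chosen so that [u <= 1], where the Lipschitz bound applies, and [K * u < normc p.[0]]. *)
pose u := normc p.[0] / (K + normc p.[0]).
have u0 : 0 < u by rewrite divr_gt0 // ltr_wpDl.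
have u1 : u <= 1 by rewrite ler_pdivrMr ?ltr_wpDl// mul1r lerDr.
exists u => // r r0; rewrite -addrA -scaleNr -scalerDl.
have [/ha//|ur] := leP 0 (- u + r).
rewrite -cev_toC_neq0 -pE; apply/eqP => pr.
have nr : normc (- u + r)%:C <= u by rewrite normc_real ltr0_norm //; lra.
have [_] : normc p.[0] <= K /\ normc (p.[0] - p.[(- u + r)%:C]) <= K * normc (0
  - (- u + r)%:C).
  by apply: lipK; rewrite ?normc0// (le_trans nr).
rewrite pr subr0 sub0r normcN leNgt => /negP; apply.
apply: le_lt_trans (_ : K * u < _); first by rewrite ler_wpM2l.
rewrite /u mulrA ltr_pdivrMr ?ltr_wpDl// mulrC ltr_pM2l//.
by rewrite ltrDl.
Qed.

(* Homotopy from 0 to x in the real part; splitting a = (a - u e) + u e keeps a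
   positive multiple of e in the imaginary part all along. *)
Lemma hyp_cone_hyperbolic a x : hyp_cone a -> cev F (toC x + 'i *: toC a) != 0.
Proof.
move=> ha; have [u u0 hu] := hyp_cone_open ha.
have Iu : 0 < Im (u%:C * 'i) by rewrite ImiRe.
have aE : toC (a - u *: e) = toC a - u%:C *: toC e by rewrite map_mxB map_mxZ.
apply/eqP => xa.
have c0 : cev F (toC (a - u *: e)) != 0.
  by rewrite cev_toC_neq0; have := hu 0 (lexx 0); rewrite scale0r addr0.
suff : Im ('i : C) < 0 by rewrite /= ltr10.
apply: (cev_homotopy (z := (u%:C * 'i) *: toC e) (z' := toC x) Fd erefl c0).
- move=> s y _; rewrite -addrA addrC -!map_mxZ -map_mxD; exact: Fe.
- by move=> t; apply: hyp_cone_lower.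
- rewrite -[RHS]xa aE; congr (cev F _).
  by rewrite scalerBr scalerA mulrC (addrC (_ *: toC e)) -addrA (addrC (_ *:
    toC e)) subrK.
Qed.

Lemma hyp_coneZ a (r : R) : hyp_cone a -> 0 < r -> hyp_cone (r *: a).
Proof.
move=> ha r0 s s0; rewrite -cev_toC_neq0.
rewrite -[s](mulVKf (lt0r_neq0 r0)) -scalerA -scalerDr map_mxZ (cev_homog _ _
  Fd).
rewrite mulf_neq0 //; first by rewrite expf_neq0 // fmorph_eq0 gt_eqF.
by rewrite cev_toC_neq0 ha // mulr_ge0 // invr_ge0 ltW.
Qed.

Lemma hyp_coneDe a (r : R) : hyp_cone a -> 0 <= r -> hyp_cone (a + r *: e).
Proof. by move=> ha r0 s s0; rewrite -addrA -scalerDl ha ?addr_ge0. Qed.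

Lemma hyp_cone_e : hyp_cone e.
Proof.
move=> s s0; rewrite -{1}[e]scale1r -scalerDl.
have := @Fe 0 'i; rewrite /= ltr01 map_mx0 add0r (cev_homog _ _ Fd) => /(_ isT).
rewrite mulf_eq0 negb_or => /andP[_];
  rewrite -cev_toC_neq0 map_mxZ (cev_homog _ _ Fd).
by move=> e0; rewrite mulf_neq0// expf_neq0// fmorph_eq0 gt_eqF// ltr_wpDr.
Qed.

(** Move the base point from [i e] to [i b] through the directions [(1 - s) e + s b], which lie in
    the cone; by [hyp_cone_hyperbolic] no root in the direction [a] becomes real. If [F] vanished at
    [a + b], then [t = i] would be a root in the upper half plane. *)
Lemma hyp_cone_line a b : hyp_cone a -> hyp_cone b -> F.@[(b + a) 0] != 0.
Proof.
move=> ha hb; rewrite -cev_toC_neq0; apply/eqP => ba.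
have c0 : cev F (toC a) != 0.
  by rewrite cev_toC_neq0; have := ha 0 (lexx 0); rewrite scale0r addr0.
suff : Im ('i : C) < 0 by rewrite /= ltr10.
apply: (cev_homotopy (z := 'i *: toC e) (z' := 'i *: toC (b - e)) Fd erefl c0).
- move=> s y /andP[s0 s1].
  rewrite addrC scalerA mulrC -scalerA -scalerDr -!map_mxZ -map_mxD.
  apply: hyp_cone_hyperbolic; rewrite scalerBr addrCA -{1}[e]scale1r -scalerBl.
  have [->|sn0] := eqVneq s 0.
    by rewrite scale0r add0r subr0 scale1r; exact: hyp_cone_e.
  have {sn0 s0}sp : 0 < s by rewrite lt_neqAle eq_sym sn0.
  rewrite -[1 - s](mulVKf (lt0r_neq0 sp)) -[(s * _) *: e]scalerA -scalerDr.
  apply: hyp_coneZ => //; apply: hyp_coneDe => //.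
  by rewrite mulr_ge0 ?subr_ge0// invr_ge0 ltW.
- by move=> t; rewrite -[X in X *: toC e]mul1r; apply: hyp_cone_lower;
  rewrite ?ltr01.
- rewrite -scalerDr -scalerDr -!map_mxD (cev_homog _ _ Fd).
  by rewrite (addrC e) subrK ba mulr0.
Qed.

Lemma hyp_coneD a b : hyp_cone a -> hyp_cone b -> hyp_cone (a + b).
Proof.
move=> ha hb s s0; rewrite -addrA addrC.
by apply: hyp_cone_line => //; apply: hyp_coneDe.
Qed.

Lemma hyp_cone_orthant x (v : 'rV[R]_k) :
  (forall j, hyp_cone (delta_mx 0 j)) -> (forall j, 0 <= v 0 j) -> v != 0 ->
  cev F (toC x + 'i *: toC v) != 0.
Proof.
move=> hd v0 vn0; apply: hyp_cone_hyperbolic.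
suff : v = 0 \/ hyp_cone v by case=> // v00; rewrite v00 eqxx in vn0.
rewrite (row_sum_delta v); apply: (big_ind (fun u => u = 0 \/ hyp_cone u)).
- by left.
- move=> a b [->|ha] [->|hb]; rewrite ?add0r ?addr0;
  [by left|by right|by right|].
  by right; apply: hyp_coneD.
- move=> j _; have := v0 j; rewrite le_eqVlt => /orP[/eqP<-|vj].
    by left; rewrite scale0r.
  by right; apply: hyp_coneZ.
Qed.

End Garding.

Lemma dhomog_mderiv (k : nat) (R : comNzRingType) (p : {mpoly R[k]}) d i :
  p \is d.+1.-homog -> p^`M(i) \is d.-homog.
Proof.
move=> pd; apply/dhomogP => m; rewrite mcoeff_msupp mcoeff_mderiv => mp.
have : (m + U_(i))%MM \in msupp p.
  by rewrite mcoeff_msupp; apply: contraNneq mp => ->; rewrite mul0rn.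
by move/(dhomog_mf pd) => /=; rewrite mdegD mdeg1 addn1 => -[].
Qed.

Lemma dhomog0E (k : nat) (R : comNzRingType) (p : {mpoly R[k]}) :
  p \is 0.-homog -> p = (p@_0%MM)%:MP.
Proof.
move=> p0; apply/mpolyP => m; rewrite mcoeffC; case: eqVneq => [<-|m0];
  first by rewrite mulr1.
rewrite mulr0; apply: (dhomog_nemf_coeff p0) => /=.
by rewrite mdeg_eq0 // eq_sym.
Qed.

Lemma dhomog0_meval (k : nat) (R : comNzRingType) (p : {mpoly R[k]}) v :
  p \is 0.-homog -> p.@[v] = p@_0%MM.
Proof. by move=> p0; rewrite {1}(dhomog0E p0) mevalC. Qed.

Lemma deriv_prod_XsubC0 (K : fieldType) (r : seq K) (c : K) (p : {poly K}) :
  0 \notin r -> p = c *: \prod_(z <- r) ('X - z%:P) ->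
  p^`().[0] = p.[0] * \sum_(z <- r) (- z)^-1.
Proof.
move=> r0 ->; rewrite derivZ !hornerZ -mulrA; congr (_ * _).
elim: r r0 => [|z r IH]; first by rewrite !big_nil derivC hornerC mulr0.
rewrite inE negb_or => /andP[z0 r0].
rewrite !big_cons derivM derivXsubC mul1r hornerD !hornerM hornerXsubC sub0r
  IH//.
rewrite mulrDr; congr (_ + _); last by rewrite mulrA.
by rewrite mulrAC mulfV ?mul1r// oppr_eq0 eq_sym.
Qed.

(** * Stability, derivatives and the inequality for products *)

Section Stability.
Local Open Scope complex_scope.
Variables (R : realType) (k : nat).
Local Notation C := R[i].
Local Notation Re := complex.Re.
Local Notation Im := complex.Im.
Local Notation toC := (map_mx (real_complex R)).
Implicit Types (F : {mpoly R[k]}) (z : 'rV[C]_k).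
Local Notation bv j := (@delta_mx _ 1 k 0 j).

(* Gauss-Lucas: all roots of t |-> F (z + t e_j) lie in the open lower half
   plane, hence so does the logarithmic derivative at t = 0. *)
Lemma cev_mderiv_neq0 F d j z : F \is d.+1.-homog -> F.@[bv j 0] != 0 ->
  (forall t : C, 0 <= Im t -> cev F (z + t *: bv j) != 0) ->
  cev F^`M(j) z != 0.
Proof.
move=> Fd Fj zt; pose p := cline F z (bv j).
have [sp pd] : (size p <= d.+2)%N /\ p`_d.+1 = cev F (bv j) by exact: cline_top.
have Fj0 : cev F (bv j) != 0.
  by rewrite -[bv j](map_delta_mx (real_complex R)) cev_toC_neq0.
have lp : lower_roots p.
  move=> t /rootP; rewrite horner_cline => /eqP pt; rewrite ltNge;
    apply/negP => /zt.
  by rewrite pt.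
have [r pr [sr rneg]] := lower_roots_factor Fj0 sp pd lp.
have r0 : 0 \notin r by apply/negP => /rneg; rewrite /= ltxx.
have := deriv_prod_XsubC0 r0 pr;
  rewrite deriv_cline !horner_cline !scale0r !addr0 => ->.
have := zt 0; rewrite scale0r addr0 /= lexx => /(_ isT) Fz.
rewrite mulf_neq0 //; suff : Im (\sum_(y <- r) (- y)^-1) < 0.
  by apply: contraTneq => ->; rewrite /= ltxx.
case: r sr rneg {pr r0} => // y r _ rneg; rewrite big_cons raddfD /=.
have neg (w : C) : Im w < 0 -> Im (- w)^-1 < 0.
  case: w => a b /= b0; rewrite oppr_lt0 divr_gt0 ?oppr_gt0//.
  by rewrite ltr_wpDl ?sqr_ge0// exprn_even_gt0//= oppr_eq0 lt_eqF.
rewrite ltr_wnDr ?neg ?rneg ?mem_head// raddf_sum big_seq;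
  apply: sumr_le0 => w wr.
by apply/ltW/neg/rneg; rewrite mem_behead.
Qed.

(** The boundary of the orthant is included except for the origin, so the coordinate directions
    themselves are admissible. *)
Definition ostable F := forall (x v : 'rV[R]_k),
  (forall j, 0 <= v 0 j) -> v != 0 -> cev F (toC x + 'i *: toC v) != 0.

(** A shift by [t] along [bv j] with [0 <= Im t] only increases the entry [j] of [v], so the
    argument stays in the stable region. *)
Lemma ostable_mderiv F d j : F \is d.+1.-homog -> F.@[bv j 0] != 0 ->
  ostable F -> ostable F^`M(j).
Proof.
move=> Fd Fj hF x v v0 vn0; apply: (cev_mderiv_neq0 Fd Fj) => -[a b] /= b0.
have -> : toC x + 'i *: toC v + (a +i* b) *: bv j =
    toC (x + a *: bv j) + 'i *: toC (v + b *: bv j).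
  rewrite !map_mxD !map_mxZ !map_delta_mx scalerDr scalerA.
  rewrite -!addrA; congr (_ + _); rewrite addrCA; congr (_ + _).
  by rewrite -scalerDl; congr (_ *: _); rewrite [LHS]complexE.
apply: hF => [l|].
  by rewrite !mxE addr_ge0 // mulr_ge0 // ler0n.
apply: contra_neq vn0 => vb; apply/rowP => l; rewrite mxE.
apply/eqP; rewrite eq_le v0 andbT; have /rowP/(_ l) := vb; rewrite !mxE => <-.
by rewrite lerDl mulr_ge0 // ler0n.
Qed.

Lemma ostable_line_roots F d i j : F \is d.+1.-homog -> ostable F ->
  0 < F.@[bv i 0] -> exists r : seq C,
  [/\ cline F (bv j) (bv i) = (F.@[bv i 0])%:C *: \prod_(y <- r) ('X - y%:P),
   size r = d.+1 & {in r, forall y : C, exists2 m : R, 0 < m & y = - m%:C}].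
Proof.
move=> Fd hF Fi; pose p := cline F (bv j) (bv i).
have [sp pd] : (size p <= d.+2)%N /\ p`_d.+1 = cev F (bv i) by exact: cline_top.
have pdE : p`_d.+1 = (F.@[bv i 0])%:C.
  by rewrite pd -[bv i](map_delta_mx (real_complex R)) cev_real.
have Fi0 : (F.@[bv i 0])%:C != 0 :> C by rewrite fmorph_eq0 gt_eqF.
have upper (t : C) : 0 < Im t -> cev F (bv j + t *: bv i) != 0.
  case: t => a b /= b0.
  have -> : bv j + (a +i* b) *: bv i =
      toC (bv j + a *: bv i) + 'i *: toC (b *: bv i).
    rewrite !map_mxD !map_mxZ !map_delta_mx scalerA.
    by rewrite -!addrA -scalerDl [in LHS](complexE (a +i* b)).
  apply: hF => [l|]; first by rewrite !mxE mulr_ge0 ?(ltW b0)// ler0n.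
  apply/eqP => /rowP/(_ i); rewrite !mxE !eqxx mulr1 => b00.
  by rewrite b00 ltxx in b0.
have roots (t : C) : root p t -> exists2 m : R, 0 < m & t = - m%:C.
  rewrite /root horner_cline => /eqP pt.
  have I1 : Im t <= 0 by rewrite leNgt; apply/negP => /upper; rewrite pt eqxx.
  have I2 : 0 <= Im t.
    rewrite leNgt; apply/negP => It;
      have : 0 < Im (t^*) by case: t It {pt I1} => u v /=; rewrite oppr_gt0.
    move/upper; rewrite -!(map_delta_mx (real_complex R)).
    rewrite -{1}(toC_conj (bv j)) -{1}(toC_conj (bv i)) -map_mxZ -map_mxD
      cev_conj.
    by rewrite !map_delta_mx pt rmorph0 eqxx.
  have Et : t = (Re t)%:C.
    by case: t {pt} I1 I2 => u v /= v0 v0'; rewrite (@le_anti _ _ v 0) ?v0.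
  exists (- Re t); last by rewrite rmorphN opprK.
  rewrite oppr_gt0 ltNge; apply/negP => t0.
  (* For a real root [t >= 0] the point [bv j + t *: bv i] lies in the orthant; multiplying by [i]
     rescales [F] by a power of [i], so stability at real part 0 gives a contradiction. *)
  have := @hF 0 (bv j + Re t *: bv i); rewrite map_mx0 add0r.
  rewrite (cev_homog _ _ Fd) toC_addZ -Et !map_delta_mx pt mulr0 eqxx => H.
  suff : false by []; apply: H => [l|].
    by rewrite !mxE addr_ge0 ?mulr_ge0 ?ler0n.
  apply/eqP => /rowP/(_ j); rewrite !mxE !eqxx /= => /eqP; apply/negP.
  by rewrite gt_eqF // ltr_pwDl // mulr_ge0 ?ler0n.
have sz : size p = d.+2.
  apply/eqP; rewrite eqn_leq sp ltnNge; apply: contraNN Fi0 => ps.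
  by rewrite -pdE nth_default.
have [r pr] := closed_field_poly_normal p.
rewrite lead_coefE sz /= pdE in pr; exists r; split=> //.
  by move: sz; rewrite pr size_scale// size_prod_XsubC => -[].
by move=> y yr; apply: roots; rewrite pr rootZ// root_prod_XsubC.
Qed.

(** With roots [- m l], the values [a], [b], [c] of [F] at [bv i], [F] at [bv j] and the derivative
    at [bv j] satisfy [b = a] times the product of the [m l], and [c = b] times the sum of their
    inverses. AM-GM is applied to these inverses, whose product is [a / b]. *)
Lemma mderiv_AGM F d i j : F \is d.+1.-homog -> ostable F ->
  0 < F.@[bv i 0] -> 0 < F.@[bv j 0] ->
  0 < F^`M(i).@[bv j 0] /\
  F.@[bv i 0] * F.@[bv j 0] ^+ d <= (F^`M(i).@[bv j 0] / d.+1%:R) ^+ d.+1.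
Proof.
move=> Fd hF a0 b0; have [r [pr sr rneg]] := ostable_line_roots j Fd hF a0.
set a := F.@[bv i 0] in a0 pr *; set b := F.@[bv j 0] in b0 *;
  set c := F^`M(i).@[bv j 0].
have evj (G : {mpoly R[k]}) : cev G (bv j) = (G.@[bv j 0])%:C.
  by rewrite -[X in cev _ X](map_delta_mx (real_complex R)) cev_real.
have r0 : 0 \notin r.
  apply/negP => /rneg[m m0 /esym/eqP].
  by rewrite oppr_eq0 fmorph_eq0 gt_eqF.
have := deriv_prod_XsubC0 r0 pr;
  rewrite deriv_cline !horner_cline !scale0r !addr0.
rewrite !evj -/b -/c => cE.
have := congr1 (fun p : {poly C} => p.[0]) pr.
rewrite horner_cline scale0r addr0 evj -/b hornerZ horner_prod => bE.
have [m mpos rE] : exists2 m : 'I_d.+1 -> R, (forall l, 0 < m l) &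
    forall l : 'I_d.+1, r`_l = - (m l)%:C.
  have /choice[m hm] : forall l : 'I_d.+1, exists m : R, 0 < m /\ r`_l = - m%:C.
    by move=> l; have [|m m0 lm] := rneg r`_l; [rewrite mem_nth ?sr|exists m].
  by exists m => l; case: (hm l).
have cE' : c = b * \sum_l (m l)^-1.
  apply: (@complexI R); rewrite cE rmorphM; congr (_ * _); rewrite rmorph_sum.
  rewrite (big_nth 0) sr big_mkord; apply: eq_bigr => l _.
  by rewrite rE opprK fmorphV.
have bE' : b = a * \prod_l m l.
  apply: (@complexI R); rewrite bE rmorphM; congr (_ * _); rewrite rmorph_prod.
  rewrite (big_nth 0) sr big_mkord; apply: eq_bigr => l _.
  by rewrite hornerXsubC sub0r rE opprK.
have sum0 : 0 < \sum_l (m l)^-1.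
  rewrite (bigD1 ord0) //= ltr_wpDr ?invr_gt0//.
  by apply: sumr_ge0 => l _; rewrite invr_ge0 ltW.
split; first by rewrite cE' mulr_gt0.
have [agm _] : \prod_(l in 'I_d.+1) (m l)^-1 <= ((\sum_(l in 'I_d.+1) (m l)^-1)
  / #|'I_d.+1|%:R) ^+ #|'I_d.+1|
    ?= iff [forall l in 'I_d.+1, forall l' in 'I_d.+1, (m l)^-1 == (m l')^-1].
  by apply: leif_AGM => l _; rewrite invr_ge0 ltW.
rewrite card_ord in agm.
have pm0 : \prod_l m l != 0 by apply/prodf_neq0 => l _; rewrite gt_eqF.
apply: (@le_trans _ _ (b ^+ d.+1 * \prod_l (m l)^-1)); last first.
  by rewrite cE' -mulrA exprMn ler_wpM2l // exprn_ge0 // ltW.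
have bP : b / \prod_l m l = a by rewrite bE' mulfK.
by rewrite prodfV exprSr -mulrA bP mulrC.
Qed.

Definition mderivs F (L : seq 'I_k) := foldl (fun p i => p^`M(i)) F L.

(** Induct on the degree, passing to the derivative in the direction of the head [i] of the list.
    The induction hypothesis bounds the values of this derivative on the tail, and [mderiv_AGM]
    bounds each of them below by values of [F]; the factors [d.+1] accumulate to the factorial. *)
Lemma garding_inequality F d (L : seq 'I_k) : size L = d.+1 ->
  F \is d.+1.-homog -> ostable F -> {in L, forall l, 0 < F.@[bv l 0]} ->
  0 < (mderivs F L)@_0 /\
  \prod_(i <- L) F.@[bv i 0] <= ((mderivs F L)@_0 / (d.+1)`!%:R) ^+ d.+1.
Proof.
elim: d F L => [|d IH] F [|i L] // [sL] Fd hF F0.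
  case: L sL F0 => // _ F0; have Fi := F0 i (mem_head _ _).
  have [c0 hc] := mderiv_AGM Fd hF Fi Fi.
  move: c0 hc; rewrite /= big_seq1 (dhomog0_meval _ (dhomog_mderiv i Fd)).
  by rewrite expr0 mulr1.
have Fi := F0 i (mem_head _ _).
have FL l : l \in L -> 0 < F.@[bv l 0] by move=> lL; rewrite F0 // mem_behead.
have Qd := dhomog_mderiv i Fd.
have hQ := ostable_mderiv Fd (lt0r_neq0 Fi) hF.
have Q0 l : l \in L -> 0 < F^`M(i).@[bv l 0].
  by move=> /FL Fl; case: (mderiv_AGM Fd hF Fi Fl).
have [T0 hT] := IH _ L sL Qd hQ Q0; rewrite /= -/(mderivs _ _); split=> //.
set T := (mderivs _ _)@_0 in T0 hT *.
have Tn0 : 0 <= T / (d.+1)`!%:R by rewrite divr_ge0 ?ler0n ?ltW.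
have TE : T / (d.+2)`!%:R = T / (d.+1)`!%:R / d.+2%:R.
  by rewrite factS natrM invfM mulrA mulrAC.
rewrite big_cons TE.
have P0 : 0 <= \prod_(l <- L) F.@[bv l 0] by rewrite big_seq prodr_ge0 // => l
  lL; rewrite ltW ?FL.
(* Each of the [d.+1] tail indices contributes one factor [F] at [bv i] through [mderiv_AGM], so the
   inequality is compared in its power [d.+1]. *)
rewrite -(@ler_pXn2r _ d.+1) ?nnegrE//; last 2 first.
- by rewrite mulr_ge0 // ltW.
- by rewrite exprn_ge0 // divr_ge0 ?ler0n.
rewrite -exprM mulnC exprM exprMn.
have -> : ((T / (d.+1)`!%:R / d.+2%:R) ^+ d.+1) ^+ d.+2 =
  ((T / (d.+1)`!%:R) ^+ d.+1) ^+ d.+2 * (d.+2%:R^-1 ^+ d.+2) ^+ d.+1 :> R.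
  by rewrite exprMn exprMn -!exprM (mulnC d.+2).
apply: (@le_trans _ _ ((\prod_(l <- L) F^`M(i).@[bv l 0]) ^+ d.+2 * (d.+2%:R^-1
  ^+ d.+2) ^+ d.+1)); last first.
  rewrite ler_wpM2r ?exprn_ge0 ?invr_ge0 ?ler0n//.
  by rewrite lerXn2r // nnegrE ?exprn_ge0// big_seq prodr_ge0 // => l lL;
    rewrite ltW ?Q0.
have constE (x : R) : x ^+ d.+1 = \prod_(l <- L) x.
  by rewrite big_const_seq count_predT sL iter_mulr mulr1.
rewrite (constE F.@[_]) (constE (_ ^-1 ^+ _)) -!prodrXl -!big_split /=.
rewrite big_seq [leRHS]big_seq; apply: ler_prod => l /FL Fl.
have [_ hl] := mderiv_AGM Fd hF Fi Fl.
rewrite -exprMn; apply/andP; split=> //.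
by apply: mulr_ge0; [|apply: exprn_ge0]; apply: ltW.
Qed.

End Stability.

(** * Pencils of hyperhermitian matrices *)

Section QuatHomogeneous.
Variables (K : idomainType) (k n : nat).
Hypothesis two_neq0 : (2 : K) != 0.

Definition qhomog d (q : quat {mpoly K[k]}) :=
  [/\ qre q \is d.-homog, qi q \is d.-homog, qj q \is d.-homog
    & qk q \is d.-homog].

Lemma qhomogM d d' q q' : qhomog d q -> qhomog d' q' -> qhomog (d + d') (q *
  q').
Proof.
case: q => a b c e [/= ha hb hc he];
  case: q' => a' b' c' e' [/= ha' hb' hc' he'].
by split; rewrite /= ?(rpredB, rpredD) // dhomogM.
Qed.

Lemma qhomogB d q q' : qhomog d q -> qhomog d q' -> qhomog d (q - q').
Proof. by move=> [? ? ? ?] [? ? ? ?]; split; rewrite /= rpredB. Qed.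

Lemma qhomog0 d : qhomog d 0.
Proof. by split; exact: rpred0. Qed.

Lemma qhomog_sum d (I : finType) (P : pred I) (f : I -> quat {mpoly K[k]}) :
  (forall i, P i -> qhomog d (f i)) -> qhomog d (\sum_(i | P i) f i).
Proof.
move=> h; apply: (big_ind (qhomog d)) => // [|q q' [? ? ? ?] [? ? ? ?]].
  exact: qhomog0.
by split; rewrite /= rpredD.
Qed.

Lemma pminor_homog (M : 'M[quat {mpoly K[k]}]_n) S :
  (forall i j, qhomog 1 (M i j)) -> pminor M S \is #|S|.-homog.
Proof.
move=> h1; suff: pminor M S \is #|S|.-homog /\
    forall i j, j \notin S -> qhomog #|S|.+1 (pschur M S i j) by case.
have [m] := ubnP #|S|; elim: m => // m IH in S * => Sm.
have Slt j : j \in S -> (#|S :\ j| < m)%N.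
  by move=> jS; rewrite -ltnS (leq_trans _ Sm) // ltnS [in leqRHS](cardsD1 j)
    jS.
have DS : pminor M S \is #|S|.-homog.
  have [->|[l lS]] := set_0Vmem S; first by rewrite pminor0 cards0 dhomog1.
  have [_ /(_ l l)] := IH _ (Slt l lS); rewrite setD11 => /(_ isT) [h _ _ _].
  rewrite (cardsD1 l S) lS add1n.
  by have := pminorU1 M (negbT (setD11 l S)); rewrite finset.setD1K // => ->.
split=> // i j jS; rewrite pschurr //; apply: qhomogB.
  rewrite -addn1; apply: qhomogM (h1 _ _).
  by split => //=; exact: rpred0.
apply: qhomog_sum => l lS; rewrite -addn1; apply: qhomogM (h1 _ _).
have [_ /(_ l j)] := IH _ (Slt l lS); rewrite !inE negb_and jS orbT.
by move=> /(_ isT); rewrite [in X in _ -> X](cardsD1 l) lS.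
Qed.

End QuatHomogeneous.

Section Pencil.
Variables (K : idomainType) (n : nat).
Hypothesis two_neq0 : (2 : K) != 0.
Implicit Types (k : nat).

(** [moore_poly] ties the number of variables to the matrix size; here they are independent, so
    equal matrices can share a variable. *)
Definition pencil k (N : 'I_k -> 'M[quat K]_n) : {mpoly K[k]} :=
  moore_det (\sum_(i < k)
    quat_real 'X_i *: map_mx (quat_map (@mpolyC k K)) (N i)).

Lemma quat_realD (L : comNzRingType) (a b : L) :
  quat_real (a + b) = quat_real a + quat_real b.
Proof. exact: raddfD. Qed.

Lemma pencil_rmorph k (N : 'I_k -> 'M[quat K]_n) (L : comNzRingType)
    (g : {rmorphism {mpoly K[k]} -> L}) (f : {rmorphism K -> L}) :
  (forall c, g c%:MP = f c) ->
  g (pencil N) = moore_det (\sum_(i < k)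
    quat_real (g 'X_i) *: map_mx (quat_map f) (N i)).
Proof.
move=> gf; rewrite /pencil -moore_det_map; congr moore_det.
apply/matrixP => a b; rewrite !mxE !summxE rmorph_sum; apply: eq_bigr => i _.
rewrite !mxE rmorphM /= quat_map_real; congr (_ * _).
by case: (N i a b) => *; apply: quatE; rewrite /= gf.
Qed.

Lemma pencil_eval k (N : 'I_k -> 'M[quat K]_n) (x : 'I_k -> K) :
  (pencil N).@[x] = moore_det (\sum_(i < k) quat_real (x i) *: N i).
Proof.
rewrite (@pencil_rmorph _ _ _ (meval x) idfun) => [|c]; last exact: mevalC.
congr moore_det; apply: eq_bigr => i _; rewrite /= mevalXU; congr (_ *: _).
by apply/matrixP => a b; rewrite mxE; case: (N i a b).
Qed.

Lemma hyperhermitian_comb (L : comNzRingType) k (N : 'I_k -> 'M[quat L]_n)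
    (x : 'I_k -> L) : (forall i, hyperhermitian (N i)) ->
  hyperhermitian (\sum_(i < k) quat_real (x i) *: N i).
Proof.
move=> hN; apply/matrixP => a b; rewrite !mxE !summxE raddf_sum.
apply: eq_bigr => i _; rewrite !mxE /= quat_conjM quat_conj_real.
by rewrite (hyperhermitianE (hN i)) quat_realC.
Qed.

Lemma hyperhermitian_map (L : comNzRingType) (f : {rmorphism K -> L})
  (A : 'M[quat K]_n) : hyperhermitian A -> hyperhermitian (map_mx (quat_map f)
    A).
Proof.
move=> hA; apply/matrixP => a b; rewrite !mxE -(hyperhermitianE hA b a).
by apply: quatE; rewrite /= ?rmorphN.
Qed.

Lemma pencil_homog k (N : 'I_k -> 'M[quat K]_n) :
  (forall i, hyperhermitian (N i)) -> pencil N \is n.-homog.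
Proof.
move=> hN; rewrite /pencil moore_detE.
- rewrite -[X in X.-homog]card_ord -cardsT; apply: pminor_homog => a b.
  rewrite summxE; apply: qhomog_sum => i _; rewrite !mxE -[1%N]addn0.
  apply: qhomogM; first by split; rewrite /= ?rpred0 // dhomogX /= mdeg1.
  by split; rewrite /= -[X in X \is _]mulr1 mul_mpolyC rpredZ // dhomog1.
- by apply: addrr_eq0; rewrite -mpolyC_nat mpolyC_eq0.
- by apply: hyperhermitian_comb => i; apply: hyperhermitian_map.
Qed.

End Pencil.

(** Allows complex polynomials to be compared at real shifts only, where they are Moore determinants
    of real quaternionic matrices. *)
Lemma poly_eq_nat (K : numDomainType) (p q : {poly K}) :
  (forall i : nat, p.[i%:R] = q.[i%:R]) -> p = q.
Proof.
move=> pq; apply/eqP; rewrite -subr_eq0; apply/eqP.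
apply: (@roots_geq_poly_eq0 _ _ [seq i%:R | i <- iota 0 (size (p - q))]).
- by apply/allP => _ /mapP[i _ ->]; rewrite /root hornerD hornerN pq subrr.
- rewrite map_inj_uniq ?iota_uniq// => i j /eqP.
  by rewrite eqr_nat => /eqP.
- by rewrite size_map size_iota.
Qed.

Lemma horner_char_poly (K : comNzRingType) N (A : 'M[K]_N) x :
  (char_poly A).[x] = \det (x%:M - A).
Proof.
rewrite -[LHS]/(horner_eval x _) /char_poly -det_map_mx; congr (\det _).
apply/matrixP => i j; rewrite !mxE /= /horner_eval hornerD hornerN hornerC.
by case: (i == j); rewrite /= ?mulr1n ?mulr0n ?hornerX ?horner0.
Qed.

Lemma coef_prod_XaddC (K : comNzRingType) n m (lam : 'I_n -> K) : (m <= n)%N ->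
  (\prod_i ('X + (lam i)%:P))`_(n - m) =
  \sum_(J : {set 'I_n} | #|J| == m) \prod_(j in J) lam j.
Proof.
move=> mn; under eq_bigr do rewrite addrC.
rewrite bigA_distr coef_sum [RHS]big_mkcond /=; apply: eq_bigr => J _.
rewrite (bigID (mem J)) /=.
rewrite [X in X * _](eq_bigr (fun j => (lam j)%:P)) => [|j]; last by move=> ->.
rewrite [X in _ * X](eq_bigr (fun=> 'X)) => [|j]; last by move/negbTE=> ->.
rewrite -rmorph_prod prodr_const mul_polyC coefZ coefXn.
have -> : #|[pred x | x \notin J]| = (n - #|J|)%N.
  have := cardC (mem J); rewrite [RHS]card_ord => e.
  by rewrite -[X in (X - _)%N]e addKn; apply: eq_card.
have Jn : (#|J| <= n)%N by rewrite -[leqRHS]card_ord max_card.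
have -> : ((n - m)%N == (n - #|J|)%N) = (#|J| == m).
  apply/eqP/eqP => [h|->//].
  by rewrite -(subKn Jn) -h subKn.
by case: eqP; rewrite ?mulr1 ?mulr0.
Qed.

Lemma monic_addr_neq0 (K : idomainType) (p q : {poly K}) : (2 : K) != 0 ->
  p \is monic -> q \is monic -> size p = size q -> p + q != 0.
Proof.
move=> two0 /monicP pm /monicP qm sz; apply: contraNneq two0 => pq.
have := congr1 (fun r : {poly K} => r`_(size p).-1) pq.
by rewrite coefD coef0 {2}sz -!lead_coefE pm qm => <-.
Qed.

(** In [p ^+ 4 - q ^+ 4 = (p - q) (p + q) (p ^+ 2 + q ^+ 2)] the last two factors have leading
    coefficient 2. *)
Lemma monic_expr4_inj (K : idomainType) (p q : {poly K}) : (2 : K) != 0 ->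
  p \is monic -> q \is monic -> p ^+ 4 = q ^+ 4 -> p = q.
Proof.
move=> two0 pm qm pq.
have sgt (r : {poly K}) : r \is monic -> (0 < size r)%N.
  by move=> rm; rewrite size_poly_gt0 monic_neq0.
have sz : (size p).-1 = (size q).-1.
  have /eqP := congr1 (fun r : {poly K} => (size r).-1) pq.
  by rewrite !size_exp eqn_pmul2r // => /eqP.
have : (p - q) * ((p + q) * (p ^+ 2 + q ^+ 2)) = 0.
  by rewrite -[0](subrr (q ^+ 4)) -{1}pq; ring.
move=> /eqP; rewrite !mulf_eq0 subr_eq0 => /or3P[/eqP//|h|h].
  by have := monic_addr_neq0 two0 pm qm;
    rewrite h -(prednK (sgt p pm)) sz (prednK (sgt q qm)) => /(_ erefl).
have p2 := monic_exp 2 pm; have q2 := monic_exp 2 qm.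
have := monic_addr_neq0 two0 p2 q2.
by rewrite h -(prednK (sgt _ p2)) -(prednK (sgt _ q2)) !size_exp sz => /(_
  erefl).
Qed.

Section Spectrum.
Local Open Scope complex_scope.
Variables (R : realType) (n : nat).
Local Notation C := R[i].

Lemma two_neq0R : (2 : R) != 0. Proof. by rewrite pnatr_eq0. Qed.

Lemma symmetric_root_real N (S : 'M[R]_N) (z : C) : S^T = S ->
  root (map_poly (real_complex R) (char_poly S)) z -> complex.Im z = 0.
Proof.
rewrite map_char_poly => ST;
  rewrite -eigenvalue_root_char => /eigenvalueP[v vS v0].
set SC := map_mx _ S in vS.
have SCT : SC^T = SC by rewrite /SC map_trmx ST.
have SCc : map_mx (@conjc R) SC = SC.
  by apply/matrixP => i j; rewrite !mxE conjc_real.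
pose w := (map_mx (@conjc R) v)^T.
have e1 : v *m SC *m w = z *: (v *m w) by rewrite vS scalemxAl.
have e2 : v *m SC *m w = (z^*) *: (v *m w).
  have : map_mx (@conjc R) (v *m SC) = z^* *: map_mx (@conjc R) v.
    by rewrite vS map_mxZ.
  rewrite map_mxM SCc => /(congr1 trmx);
    rewrite trmx_mul SCT linearZ /= -/w => h.
  by rewrite -mulmxA h scalemxAr.
have n0 : (v *m w) 0 0 != 0.
  rewrite mxE; apply/eqP => /eqP.
  under eq_bigr do rewrite !mxE.
  rewrite psumr_eq0 => [/allP h|i _]; last exact: mulcJ_ge0.
  have/eqP := v0; apply; apply/rowP => i; rewrite mxE.
  have := h i (mem_index_enum _); rewrite /= mulf_eq0 conjc_eq0 orbb.
  by move/eqP.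
have : z * (v *m w) 0 0 = z^* * (v *m w) 0 0.
  by have := congr1 (fun M : 'M[C]_1 => M 0 0) (etrans (esym e1) e2);
    rewrite !mxE.
move/(mulIf n0); case: z {vS e1 e2} => a b [] /eqP.
by rewrite -addr_eq0 -mulr2n mulrn_eq0 /= => /eqP.
Qed.

Lemma hyperhermitian_shift (A : 'M[quat R]_n) (s : R) : hyperhermitian A ->
  hyperhermitian ((quat_real s)%:M + A).
Proof.
move=> hA; apply/matrixP => i j; rewrite !mxE raddfD /= (hyperhermitianE hA).
rewrite eq_sym; congr (_ + _); case: (j == i) => /=.
  by rewrite !mulr1n quat_conj_real.
by rewrite !mulr0n (quat_conj_real (0 : R)).
Qed.

Lemma moore_det_symmetric (A : 'M[quat R]_n) (s : R) : hyperhermitian A ->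
  moore_det ((quat_real s)%:M + A) ^+ 4 = (char_poly (- rmx A)).[s].
Proof.
move=> hA; rewrite -(moore_det4 two_neq0R); last exact: hyperhermitian_shift.
by rewrite /rdet rmxD rmx_scalar horner_char_poly opprK.
Qed.

Lemma moore_det_spectrum (A : 'M[quat R]_n) (lam : 'rV[R]_n) (s : R) :
  hyperhermitian A -> is_spectrum A lam ->
  moore_det ((quat_real s)%:M + A) ^+ 4 = (\prod_j (s + lam 0 j)) ^+ 4.
Proof.
move=> hA [U [[UU _] AE]].
rewrite -(moore_det4 two_neq0R); last exact: hyperhermitian_shift.
have -> : (quat_real s)%:M + A =
  U *m diag_mx (map_mx (@quat_real R) (\row_j (s + lam 0 j))) *m adjmx U.
  have -> : diag_mx (map_mx (@quat_real R) (\row_j (s + lam 0 j))) =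
      (quat_real s)%:M + diag_mx (map_mx (@quat_real R) lam).
    apply/matrixP => i j; rewrite !mxE; case: (i == j) => //=.
      by rewrite !mulr1n quat_realD.
    by rewrite !mulr0n addr0.
  rewrite mulmxDr mulmxDl -AE; congr (_ + _).
  have -> : U *m (quat_real s)%:M = (quat_real s)%:M *m U.
    rewrite mul_scalar_mx -diag_const_mx; apply/matrixP => i j.
    by rewrite mul_mx_diag !mxE quat_realC.
  by rewrite -mulmxA UU mulmx1.
rewrite !rdetM rdet_diag mulrAC -rdetM UU rdet1 mul1r; congr (_ ^+ 4).
by apply: eq_bigr => j _; rewrite mxE.
Qed.

End Spectrum.

(** Every index of [L] occurs once and is absent from [m], so the derivatives produce no numerical
    factors. *)
Lemma mcoeff_mderivs (R : comNzRingType) k (p : {mpoly R[k]}) (L : seq 'I_k)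
    (m : 'X_{1..k}) : uniq L -> {in L, forall i, m i = 0%N} ->
  (foldl (fun q i => q^`M(i)) p L)@_m = p@_(m + \sum_(i <- L) U_(i)).
Proof.
elim: L p => [|i L IH] p /=; first by rewrite big_nil addm0.
case/andP=> iL uL m0; rewrite IH // => [|l lL];
  last by rewrite m0 // mem_behead.
have S0 : (\sum_(l <- L) U_(l)%MM i = 0)%N.
  rewrite big_seq big1 // => l lL; rewrite mnm1E; case: eqP => // li.
  by rewrite -li lL in iL.
rewrite mcoeff_mderiv mnmDE m0 ?mem_head // mnm_sumE S0 mulr1n.
by rewrite big_cons [(U_(i) + _)%MM]addmC addmA.
Qed.

(** Variable [i] contributes only through [h (c i)], with derivative 1, so the chain rule keeps a
    single term. *)
Lemma mderivs_mmap (R : comNzRingType) k k' (h : 'I_k -> {mpoly R[k']})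
    (c : 'I_k' -> 'I_k) (p : {mpoly R[k]}) (L : seq 'I_k') :
  (forall i l, (h l)^`M(i) = (l == c i)%:R) ->
  foldl (fun q i => q^`M(i)) (mmap (@mpolyC k' R) h p) L =
  mmap (@mpolyC k' R) h (foldl (fun q i => q^`M(i)) p (map c L)).
Proof.
move=> hc; elim: L p => //= i L IH p; rewrite -IH; congr foldl.
rewrite (@mmap_chain _ _ _ _ _ (mderiv i) p (@mderivM _ _ i)) => [|a];
  last exact: mderivC.
rewrite (bigD1 (c i)) //= hc eqxx mulr1 big1 ?addr0 // => l li.
by rewrite hc (negbTE li) mulr0.
Qed.

Section HyperbolicPencil.
Local Open Scope complex_scope.
Variables (R : realType) (k : nat).
Local Notation C := R[i].
Local Notation Im := complex.Im.
Local Notation toC := (map_mx (real_complex R)).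
Local Notation bv j := (@delta_mx _ 1 k 0 j).

Definition hyperbolic (F : {mpoly R[k]}) (e : 'rV[R]_k) :=
  forall (x : 'rV[R]_k) (s : C), 0 < Im s -> cev F (toC x + s *: toC e) != 0.

Lemma hyperbolic_mderivs (F : {mpoly R[k]}) d l j :
  F \is (d + j).-homog -> hyperbolic F (bv l) ->
  mderivs F (nseq j l) \is d.-homog /\ hyperbolic (mderivs F (nseq j l)) (bv l).
Proof.
elim: j F => [|j IH] F; first by rewrite addn0.
rewrite addnS => Fd hF; apply: IH; first exact: dhomog_mderiv.
move=> x s s0; apply: (cev_mderiv_neq0 Fd) => [|t t0].
  by have := hyp_cone_e Fd hF (lexx 0); rewrite scale0r addr0.
rewrite map_delta_mx -addrA -scalerDl -(map_delta_mx (real_complex R)).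
by apply: hF; rewrite raddfD /= ltr_wpDr.
Qed.

Lemma derivn_cline (F : {mpoly R[k]}) z l j :
  (cline F z (bv l))^`(j) = cline (mderivs F (nseq j l)) z (bv l).
Proof.
elim: j F => [|j IH] F; first by rewrite derivn0.
by rewrite derivSn deriv_cline IH.
Qed.

Variables (n : nat) (N : 'I_k -> 'M[quat R]_n) (l0 : 'I_k).
Hypotheses (hN : forall l, hyperhermitian (N l)) (N0 : N l0 = 1%:M).
Local Notation F := (pencil N).
Local Notation comb x := (\sum_(l < k) quat_real (x 0 l) *: N l).

Lemma pencil_shift (x : 'rV[R]_k) (u : R) :
  F.@[(x + u *: bv l0) 0] = moore_det ((quat_real u)%:M + comb x).
Proof.
rewrite pencil_eval; congr moore_det.
have -> : (quat_real u)%:M = \sum_(l < k) quat_real (u * (l == l0)%:R) *: N l.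
  rewrite (bigD1 l0) //= eqxx mulr1 N0 big1 ?addr0 ?scalemx1 // => l /negbTE->.
  by rewrite mulr0 rmorph0 scale0r.
rewrite addrC -big_split; apply: eq_bigr => l _.
by rewrite !mxE quat_realD scalerDl.
Qed.

Lemma cline_pencil_nat x (i : nat) :
  (cline F (toC x) (bv l0)).[i%:R] =
  (moore_det ((quat_real i%:R)%:M + comb x))%:C.
Proof.
rewrite horner_cline -(map_delta_mx (real_complex R)) -(rmorph_nat
  (real_complex R)).
by rewrite -toC_addZ cev_real pencil_shift.
Qed.

Lemma hyperbolic_pencil : hyperbolic F (bv l0).
Proof.
move=> x s s0; rewrite map_delta_mx -horner_cline.
have hx : hyperhermitian (comb x) by apply: hyperhermitian_comb.
have P4 : (cline F (toC x) (bv l0)) ^+ 4 =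
    map_poly (real_complex R) (char_poly (- rmx (comb x))).
  apply: poly_eq_nat => i; rewrite horner_exp cline_pencil_nat -rmorphXn.
  rewrite (moore_det_symmetric _ hx) -(rmorph_nat (real_complex R)).
  by rewrite horner_map.
apply/eqP => Ps; have sym : (- rmx (comb x))^T = - rmx (comb x).
  by rewrite linearN /= -rmx_adj -hx.
have := @symmetric_root_real R _ _ s sym;
  rewrite -P4 /root horner_exp Ps expr0n.
by move=> /(_ (eqxx _)) Is; rewrite Is ltxx in s0.
Qed.

Lemma pencil_top : F.@[bv l0 0] = 1.
Proof.
have := pencil_shift 0 1; rewrite scale1r add0r => ->.
rewrite big1 => [|l _]; last by rewrite mxE rmorph0 scale0r.
rewrite addr0 moore_detE ?pminor1 //; first exact: (addrr_eq0 (two_neq0R R)).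
exact: hyperhermitian1.
Qed.

Lemma mderivs_pencil m (x : 'rV[R]_k) (lam : 'rV[R]_n) : (m <= n)%N ->
  is_spectrum (comb x) lam ->
  (mderivs F (nseq (n - m) l0)).@[x 0] =
  (n - m)`!%:R * \sum_(J : {set 'I_n} | #|J| == m) \prod_(j in J) lam 0 j.
Proof.
move=> mn sp; pose P := cline F (toC x) (bv l0).
have hx : hyperhermitian (comb x) by apply: hyperhermitian_comb.
have Fd : F \is n.-homog by apply: pencil_homog => //; exact: two_neq0R.
have [sP Pn] := cline_top (toC x) (bv l0) Fd.
have {}Pn : P`_n = 1.
  by rewrite Pn -(map_delta_mx (real_complex R)) cev_real pencil_top.
have Pm : P \is monic.
  have sz : size P = n.+1.
    apply/eqP; rewrite eqn_leq sP ltnNge; apply/negP => h.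
    by move/eqP: Pn; rewrite nth_default // eq_sym oner_eq0.
  by rewrite monicE lead_coefE sz Pn.
have PE : P = \prod_j ('X + (lam 0 j)%:C%:P).
  apply: monic_expr4_inj => //; first by rewrite pnatr_eq0.
    by apply: monic_prod => j _; rewrite monicXaddC.
  apply: poly_eq_nat => i; rewrite !horner_exp cline_pencil_nat -rmorphXn.
  rewrite (moore_det_spectrum _ hx sp) rmorphXn rmorph_prod horner_prod.
  congr (_ ^+ _); apply: eq_bigr => j _.
  by rewrite hornerD hornerX hornerC rmorphD rmorph_nat.
apply: (@complexI R); rewrite -cev_real.
have := horner_cline (mderivs F (nseq (n - m) l0)) (toC x) (bv l0) 0.
rewrite scale0r addr0 => <-;
  rewrite -derivn_cline horner_coef0 coef_derivn addn0.
rewrite ffactnn -/P PE coef_prod_XaddC // rmorphM rmorph_nat mulr_natl.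
congr (_ *+ _); rewrite rmorph_sum; apply: eq_bigr => J _.
by rewrite rmorph_prod.
Qed.

End HyperbolicPencil.

Lemma prod_powR_le (R : realType) m (h : 'I_m -> R) (t : R) : (0 < m)%N ->
  (forall i, 0 <= h i) -> 0 <= t -> \prod_i h i <= t ^+ m ->
  \prod_i h i `^ m%:R^-1 <= t.
Proof.
move=> m0 h0 t0 ht; rewrite -(@ler_pXn2r _ m) ?nnegrE//; last first.
  by apply: prodr_ge0 => i _; exact: powR_ge0.
rewrite -prodrXl; under eq_bigr => i _.
  rewrite -powR_mulrn ?powR_ge0// -powRrM mulVf ?pnatr_eq0 ?lt0n_neq0//
    powRr1//.
  over.
exact: ht.
Qed.

Lemma mderivs_dhomog (R : realType) k (p : {mpoly R[k]}) (L : seq 'I_k) :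
  p \is (size L).-homog -> mderivs p L \is 0.-homog.
Proof. by elim: L p => //= l L IH p pd; apply: IH; exact: dhomog_mderiv. Qed.

(** * The mixed determinant as a derivative in [m + 1] variables *)

Section MixedPencil.
Variables (R : realType) (n m : nat) (A : 'I_m -> 'M[quat R]_n).

(* The last variable carries the identity matrix. *)
Definition padded (l : 'I_m.+1) : 'M[quat R]_n :=
  if insub (val l) is Some j then A j else 1%:M.

Definition fold_idx (i : 'I_n) : 'I_m.+1 := inord (minn i m).

Lemma padded_max : padded ord_max = 1%:M.
Proof. by rewrite /padded insubN //= ltnn. Qed.

Lemma padded_widen (j : 'I_m) : padded (widen_ord (leqnSn m) j) = A j.
Proof. by rewrite /padded /= valK. Qed.

Lemma val_fold_idx i : val (fold_idx i) = minn i m.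
Proof. by rewrite /= inordK // ltnS geq_minr. Qed.

Lemma padded_fold i : padded (fold_idx i) = pad_id A i.
Proof.
rewrite /padded /pad_id val_fold_idx; case: (ltnP i m) => [//|im].
by rewrite !insubN // -leqNgt.
Qed.

(** The coefficient that variable [l] of the small pencil receives: one ['X_i] for each matrix
    [A l], and for the last [l] the sum of all variables attached to identity matrices. *)
Definition fold_var (l : 'I_m.+1) : {mpoly R[n]} :=
  \sum_(i < n | fold_idx i == l) 'X_i.

Lemma mderiv_fold_var i l : (fold_var l)^`M(i) = (l == fold_idx i)%:R.
Proof.
have dX j : ('X_j : {mpoly R[n]})^`M(i) = (j == i)%:R.
  rewrite mderivX mnm1E; case: (j =P i) => [->|_]; last by rewrite scale0r.
  rewrite scale1r (_ : (U_(i) - U_(i))%MM = 0%MM) ?mpolyX0 //.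
  by apply/mnmP => j'; rewrite mnmBE mnm0E subnn.
rewrite /fold_var raddf_sum /=; under eq_bigr do rewrite dX.
rewrite big_mkcond (bigD1 i) //= eqxx big1 => [|j /negbTE ji].
  by rewrite addr0 eq_sym; case: ifP.
by rewrite ji; case: ifP.
Qed.

Lemma moore_poly_fold :
  moore_poly (pad_id A) = mmap (@mpolyC n R) fold_var (pencil padded).
Proof.
rewrite (@pencil_rmorph _ _ _ _ _ (mmap (@mpolyC n R) fold_var) (@mpolyC n R));
  last first.
  exact: mmapC.
congr moore_det; rewrite (partition_big fold_idx xpredT) //=.
apply: eq_bigr => l _; rewrite mmapX mmap1U /fold_var rmorph_sum scaler_suml.
by apply: eq_bigr => i /eqP <-; rewrite padded_fold.
Qed.

End MixedPencil.

Theorem corollary2p2 (R : realType) (n m : nat) (hm : (1 <= m <= n)%N)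
    (A : 'I_m -> 'M[quat R]_n) (hA : forall i : 'I_m, Gamma m (A i)) :
  \prod_(i < m) (esym_eig m (A i)) `^ (m%:R^-1)
    <= ('C(n, m))%:R * mixed_det (pad_id A).
Proof.
have [m0 mn] := andP hm.
pose N := padded A; pose F := pencil N; pose sv : 'I_m.+1 := ord_max.
pose wd := widen_ord (leqnSn m).
have N0 : N sv = 1%:M by exact: padded_max.
have hN l : hyperhermitian (N l).
  rewrite /N /padded; case: insub => [j|]; last exact: hyperhermitian1.
  by case: (hA j).
have Fd : F \is n.-homog by apply: pencil_homog => //; exact: two_neq0R.
pose G := mderivs F (nseq (n - m) sv).
have [Gd hG] : G \is m.-homog /\ hyperbolic G (delta_mx 0 sv).
  apply: hyperbolic_mderivs; first by rewrite subnKC.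
  exact: hyperbolic_pencil.
(* If [B] had no spectrum, [eigenvalues B] would be the default 0; as [1 <= m], every product in
   [esym_eig] would contain a zero factor, against positivity. *)
have esym_spectrum (B : 'M[quat R]_n) : 0 < esym_eig m B ->
    is_spectrum B (eigenvalues B).
  move=> B0; rewrite /eigenvalues; case: xgetP => // none.
  move: B0; rewrite /esym_eig /eigenvalues; case: xgetP => [lam _ /none//|_].
  rewrite big1 ?ltxx // => J /eqP Jm; have : (0 < #|J|)%N by rewrite Jm.
  by case/card_gt0P => j jJ; rewrite (bigD1 j) //= mxE mul0r.
(* This translates [Gamma m (A j)] into the statement that the coordinate vector of [A j] lies in
   the cone of [G]. *)
have Gval j (r : R) : 0 <= r ->
    G.@[(delta_mx 0 (wd j) + r *: delta_mx 0 sv : 'rV[R]_m.+1) 0] =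
    (n - m)`!%:R * esym_eig m ((quat_real r)%:M + A j).
  move=> r0; have [_ /(_ r r0) Aj] := hA j.
  have := esym_spectrum _ Aj.
  have combE : \sum_(l < m.+1) quat_real ((delta_mx 0 (wd j) + r *: delta_mx 0
    sv : 'rV[R]_m.+1) 0 l) *: N l
      = (quat_real r)%:M + A j.
    rewrite (bigD1 (wd j)) //= (bigD1 sv) /=; last first.
      by rewrite -val_eqE /= eq_sym neq_ltn ltn_ord.
    rewrite big1 => [|l /andP[/negbTE lj /negbTE ls]].
      rewrite !mxE !eqxx /= addr0 N0 scalemx1 addrC; congr (_ + _).
        by rewrite -val_eqE /= gtn_eqF ?ltn_ord // add0r mulr1.
      rewrite -val_eqE /= ltn_eqF ?ltn_ord // mulr0 addr0.
      by rewrite rmorph1 scale1r [LHS]padded_widen.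
    by rewrite !mxE lj ls /= mulr0 addr0 rmorph0 scale0r.
  rewrite -combE => sp; rewrite /G /F (mderivs_pencil hN N0 mn sp).
  by rewrite /esym_eig combE.
have esym0 j : 0 < esym_eig m (A j).
  have [_ /(_ 0 (lexx _))] := hA j.
  by rewrite rmorph0 add0r.
have Gval0 j : G.@[(delta_mx 0 (wd j) : 'rV[R]_m.+1) 0] = (n - m)`!%:R *
  esym_eig m (A j).
  have := Gval j 0 (lexx 0); rewrite scale0r addr0 => ->.
  by rewrite rmorph0 add0r.
have Gpos j : 0 < G.@[(delta_mx 0 (wd j) : 'rV[R]_m.+1) 0].
  by rewrite Gval0 mulr_gt0 // ltr0n fact_gt0.
have Gst : ostable G.
  move=> x v v0 vn0; apply: (hyp_cone_orthant Gd hG) => // l.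
  have [lm|lm] := ltnP l m.
    have -> : l = wd (Ordinal lm) by apply: val_inj.
    move=> r r0; rewrite Gval // mulf_neq0 ?pnatr_eq0 -?lt0n ?fact_gt0//.
    by have [_ /(_ r r0) /lt0r_neq0] := hA (Ordinal lm).
  have -> : l = sv by apply: val_inj; apply/eqP;
    rewrite eqn_leq lm -ltnS ltn_ord.
  exact: hyp_cone_e Gd hG.
pose L1 := [seq i : 'I_n <- enum 'I_n | (i < m)%N].
pose L2 := [seq i : 'I_n <- enum 'I_n | ~~ (i < m)%N].
(* The identity indices [L2] come first, so that their derivatives produce [G] before those in the
   directions [A j] are taken. *)
have L12 : perm_eq (L2 ++ L1) (enum 'I_n).
  by rewrite perm_catC; apply/permPl/perm_filterC.
have fold1 (j : 'I_m) : fold_idx m (widen_ord mn j) = wd j.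
  by apply: val_inj; rewrite val_fold_idx /= (minn_idPl (ltnW (ltn_ord j))).
have big1E (P : 'I_n -> R) : \prod_(i <- L1) P i = \prod_(j < m) P (widen_ord
  mn j).
  by rewrite big_filter big_enum_cond /= (big_ord_narrow mn).
have sL1 : size L1 = m.
  by rewrite -sum1_size big_filter big_enum_cond /= (big_ord_narrow mn)
    sum1_card card_ord.
have sL2 : size L2 = (n - m)%N.
  by have := perm_size L12;
    rewrite size_cat sL1 size_enum_ord => /(canRL (addnK m)).
have cL2 : map (fold_idx m) L2 = nseq (n - m) sv.
  rewrite -sL2 -(size_map (fold_idx m));
    apply/all_pred1P/allP => x /mapP[i + ->].
  rewrite mem_filter -leqNgt => /andP[im _].
  by apply/eqP/val_inj; rewrite val_fold_idx /= (minn_idPr im).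
have coefE : (moore_poly (pad_id A))@_[multinom 1%N | i < n] =
    (mderivs G (map (fold_idx m) L1))@_0%MM.
  have G0 : mderivs G (map (fold_idx m) L1) \is 0.-homog.
    by apply: mderivs_dhomog; rewrite size_map sL1.
  have -> : [multinom 1%N | i < n] = (0 + \sum_(i <- L2 ++ L1) U_(i))%MM.
    rewrite add0m (perm_big _ L12) /= big_enum; apply/mnmP => i.
    rewrite mnmE mnm_sumE (bigD1 i) //= mnm1E eqxx big1 // => j /negbTE ji.
    by rewrite mnm1E ji.
  rewrite -mcoeff_mderivs; last 2 first.
  - by rewrite (perm_uniq L12) enum_uniq.
  - by move=> i _; rewrite mnm0E.
  rewrite moore_poly_fold (@mderivs_mmap _ _ _ _ (fold_idx m));
    last by move=> i l; exact: mderiv_fold_var.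
  rewrite map_cat foldl_cat cL2 -/(mderivs _ _) -/(mderivs _ _).
  rewrite -[X in mmap _ _ X]/(mderivs G (map (fold_idx m) L1)).
  by rewrite [X in mmap _ _ X](dhomog0E G0) mmapC mcoeffC eqxx mulr1.
have GL : {in map (fold_idx m) L1, forall l, 0 < G.@[(delta_mx 0 l :
  'rV[R]_m.+1) 0]}.
  move=> l /mapP[i + ->]; rewrite mem_filter => /andP[im _].
  have -> : i = widen_ord mn (Ordinal im) by apply: val_inj.
  by rewrite fold1.
have sL : size (map (fold_idx m) L1) = m.-1.+1 by rewrite size_map sL1 prednK.
have Gd' : G \is (m.-1.+1).-homog by rewrite prednK.
have [T0] := garding_inequality sL Gd' Gst GL; rewrite prednK //.
rewrite -coefE big_map big1E; under eq_bigr do rewrite fold1 Gval0.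
rewrite /mixed_det; set T := _@__ => hT; rewrite -coefE -/T in T0.
have f0 k : 0 < k`!%:R :> R by rewrite ltr0n fact_gt0.
have fn0 k : k`!%:R != 0 :> R by rewrite gt_eqF.
(* The factor [m!] is the constant of [garding_inequality]; each of the [m] values of [G] carries a
   factor [(n - m)!], and one such factor is left after the root of order [m]. *)
have -> : 'C(n, m)%:R * (T / n`!%:R) = T / m`!%:R / (n - m)`!%:R.
  have e : n`!%:R = 'C(n, m)%:R * (m`!%:R * (n - m)`!%:R) :> R.
    by rewrite -!natrM bin_fact.
  have C0 : 'C(n, m)%:R != 0 :> R by rewrite pnatr_eq0 -lt0n bin_gt0.
  by rewrite e; field; rewrite C0 !fn0.
apply: prod_powR_le => // [i||].
- exact: ltW.
- by rewrite !divr_ge0 ?ler0n // ltW.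
- rewrite [leRHS]exprMn exprVn ler_pdivlMr ?exprn_gt0//.
  rewrite mulrC -[X in _ ^+ X](card_ord m) -prodr_const -big_split.
  exact: hT.
Qed.
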